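(* Let $K$ be an algebraically closed field with $\mathrm{char}(K)=0$. Let $G={}^2\!B_2(q)$ with $q=2^{2m+1}$, $m\ge1$, be a simple Suzuki group. Then exactly the irreducible characters of degree $q^2+1$ are imprimitive. They are Harish-Chandra induced from certain linear characters of a Borel subgroup of $G$. We have $|\mathrm{Irr}(G)|=q+3$, and $q/2-1$ of these characters are imprimitive.
   Context: Characters are $K$-characters. An irreducible character of $G$ is imprimitive if it is induced from a character of some proper subgroup of $G$. Harish-Chandra induction from a Borel subgroup $B$ with torus $T$ means inducing to $G$ the inflation to $B$ of a character of $T$. *)

(* Defs.v *)
From mathcomp Require Import all_boot all_order all_algebra.
From mathcomp Require Import all_fingroup all_field all_character.
From mathcomp Require Import ring.

Set Implicit Arguments.
Unset Strict Implicit.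
Unset Printing Implicit Defensive.

Import GroupScope GRing.Theory.
Local Open Scope ring_scope.

Section Characters.

(* K-characters over an arbitrary field K (the library's 'CF(G) is tied to    *)
(* algC). As for 'CF(G), a class function on G <= gT is a function on the     *)
(* whole of gT that vanishes outside G, and the zero function is the          *)
(* character of the representation of degree 0.                               *)

Variables (K : fieldType) (gT : finGroupType).
Implicit Types (G H B U T : {group gT}) (chi phi lam : {ffun gT -> K}).

Definition char_of G n (rG : mx_representation K G n) : {ffun gT -> K} :=
  [ffun x => if x \in G then \tr (rG x) else 0].

Definition is_char G chi : Prop :=
  exists n (rG : mx_representation K G n), chi = char_of rG.

Definition is_linear_char G chi : Prop :=
  exists rG : mx_representation K G 1, chi = char_of rG.

Definition is_irr_char G chi : Prop :=
  exists n (rG : mx_representation K G n),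
    mx_irreducible rG /\ chi = char_of rG.

Definition char_Ind G H phi : {ffun gT -> K} :=
  [ffun x => if x \in G then #|H|%:R^-1 * \sum_(y in G) phi (x ^ y)%g else 0].

Definition imprimitive G chi : Prop :=
  is_irr_char G chi /\
  exists H phi, [/\ H \proper G, is_char H phi & chi = char_Ind G H phi].

(* For B = U ><| T, remgr U T x is the t in T such that x = u * t, u in U. *)
Definition char_Infl B U T lam : {ffun gT -> K} :=
  [ffun x => if x \in B then lam (remgr U T x) else 0].

Definition HC_Ind G B U T lam : {ffun gT -> K} :=
  char_Ind G B (char_Infl B U T lam).

End Characters.

Definition has_exactly (T : eqType) (P : T -> Prop) (n : nat) : Prop :=
  exists s : seq T, [/\ uniq s, forall x, x \in s <-> P x & size s = n].

Section Matrices.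

Variable F : finFieldType.
Implicit Types (A : 'M[F]_4) (g : {'GL_4[F]}).

(* The fields of interest have characteristic 2, where this symmetric form   *)
(* is alternating.                                                            *)
Definition sp4_form : 'M[F]_4 := \matrix_(i, j) (i + j == 3)%N%:R.

Definition is_sp4 A : bool := A^T *m sp4_form *m A == sp4_form.

Definition ext2_row (i : 'I_4) : 'I_4 * 'I_4 :=
  nth (ord0, ord0)
    [:: (inord 0, inord 1); (inord 0, inord 2);
        (inord 1, inord 3); (inord 2, inord 3)] i.

(* The exceptional isogeny of Sp_4 in characteristic 2. Let V be the natural  *)
(* module with basis e_0, ..., e_3 and w = e_0^e_3 + e_1^e_2 the invariant    *)
(* bivector in Ext^2(V). Then w^perp / <w> has basis the classes of e_0^e_1,  *)
(* e_0^e_2, e_1^e_3, e_2^e_3, on which the wedge product induces the form     *)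
(* sp4_form again; the matrix of A on this quotient consists of the 2 x 2     *)
(* minors of A for these four pairs. Its square is A |-> (A_ij ^ 2)_ij.       *)
Definition sp4_isogeny A : 'M[F]_4 :=
  \matrix_(i, j)
    let r := ext2_row i in let c := ext2_row j in
    A r.1 c.1 * A r.2 c.2 - A r.1 c.2 * A r.2 c.1.

(* The Steinberg endomorphism whose square is the q-Frobenius map, where      *)
(* q = 2 ^ (2m+1). In particular all its fixed points over an algebraic       *)
(* closure of F_q lie in Sp_4(q).                                             *)
Definition steinberg m A : 'M[F]_4 :=
  sp4_isogeny (map_mx (fun x => x ^+ (2 ^ m)%N) A).

Definition suzuki_set m : {set {'GL_4[F]}} :=
  [set g : {'GL_4[F]} | is_sp4 g & steinberg m g == g].

Definition lower_triangular_set : {set {'GL_4[F]}} :=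
  [set g : {'GL_4[F]} | is_trig_mx (g : 'M[F]_4)].

Definition lower_unitriangular_set : {set {'GL_4[F]}} :=
  [set g : {'GL_4[F]} | is_trig_mx (g : 'M[F]_4)
                      & [forall i : 'I_4, (g : 'M[F]_4) i i == 1]].

Definition diagonal_set : {set {'GL_4[F]}} :=
  [set g : {'GL_4[F]} | is_diag_mx (g : 'M[F]_4)].

Lemma GL4_mulE (x y : {'GL_4[F]}) :
  GLval (x * y)%g = GLval x *m GLval y :> 'M[F]_4.
Proof. by []. Qed.

Lemma GL4_oneE : GLval (1%g : {'GL_4[F]}) = 1%:M :> 'M[F]_4.
Proof. by []. Qed.

Lemma lower_triangular_group_set : group_set lower_triangular_set.
Proof.
apply/group_setP; split=> [|x y].
  by rewrite inE; apply/is_trig_mxP=> i j /ltn_eqF; rewrite !mxE -val_eqE => ->.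
rewrite !inE => /is_trig_mxP tx /is_trig_mxP ty.
apply/is_trig_mxP=> i j ltij; rewrite GL4_mulE mxE big1 // => k _.
case: (ltnP i k) => [/tx->|leki]; first by rewrite mul0r.
by rewrite ty ?mulr0 // (leq_ltn_trans leki).
Qed.
Canonical lower_triangular := Group lower_triangular_group_set.

Lemma lower_unitriangular_group_set : group_set lower_unitriangular_set.
Proof.
apply/group_setP; split=> [|x y].
  rewrite inE; apply/andP; split; last first.
    by apply/forallP=> i; rewrite !mxE eqxx.
  by apply/is_trig_mxP=> i j /ltn_eqF; rewrite !mxE -val_eqE => ->.
rewrite !inE => /andP[Tx /forallP ux] /andP[Ty /forallP uy].
have: (x * y)%g \in lower_triangular by rewrite groupM ?inE.
rewrite inE => ->; apply/forallP=> i.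
move: Tx Ty => /is_trig_mxP tx /is_trig_mxP ty.
rewrite GL4_mulE mxE (bigD1 i) //= (eqP (ux i)) (eqP (uy i)) mulr1 big1 ?addr0 //.
move=> k neqki; case: (ltngtP i k) => [/tx->|/ty->|/val_inj eqik].
- by rewrite mul0r.
- by rewrite mulr0.
- by rewrite eqik eqxx in neqki.
Qed.
Canonical lower_unitriangular := Group lower_unitriangular_group_set.

Lemma diagonal_group_set : group_set diagonal_set.
Proof.
apply/group_setP; split=> [|x y].
  rewrite inE; apply/is_diag_mxP=> i j /negPf.
  by rewrite !mxE -val_eqE => ->.
rewrite !inE => /is_diag_mxP dx /is_diag_mxP dy.
apply/is_diag_mxP=> i j neqij; rewrite GL4_mulE mxE big1 // => k _.
case: (eqVneq (i : nat) k) => [eqik|/dx->]; last by rewrite mul0r.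
by rewrite dy ?mulr0 // -eqik.
Qed.
Canonical diagonal := Group diagonal_group_set.

Variable m : nat.
Hypothesis cardF : #|F| = (2 ^ (2 * m).+1)%N.

Lemma suzuki_pchar : 2 \in [pchar F].
Proof. exact: (card_finPcharP cardF). Qed.

Lemma suzuki_frobD : {morph (fun x : F => x ^+ (2 ^ m)) : x y / x + y}.
Proof.
move=> x y; elim: m => [|k IHk]; first by rewrite !expr1.
by rewrite expnSr !exprM IHk -!(pFrobenius_autE suzuki_pchar) rmorphD.
Qed.

Definition frob4 A : 'M[F]_4 := map_mx (fun x => x ^+ (2 ^ m)) A.

Lemma frob4M : {morph frob4 : A B / A *m B}.
Proof.
move=> A B; rewrite /frob4; apply/matrixP=> i j; rewrite !mxE.
rewrite (big_morph _ suzuki_frobD (_ : _ = 0)) ?expr0n ?expn_eq0 //.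
by apply: eq_bigr => k _; rewrite !mxE exprMn.
Qed.

Lemma frob4_form : frob4 sp4_form = sp4_form.
Proof.
apply/matrixP=> i j; rewrite !mxE.
by case: eqP; rewrite ?expr1n // expr0n expn_eq0.
Qed.

Lemma frob4_sp4 A : is_sp4 A -> is_sp4 (frob4 A).
Proof.
rewrite /is_sp4 => /eqP defA; rewrite -{1}frob4_form.
have -> : (frob4 A)^T = frob4 A^T by rewrite /frob4 map_trmx.
by rewrite -!frob4M defA frob4_form.
Qed.

Lemma suzuki_two0 : 2%:R = 0 :> F.
Proof. exact: pcharf0 suzuki_pchar. Qed.

Lemma sp4_form_sq : sp4_form *m sp4_form = 1%:M.
Proof.
apply/matrixP=> i j; rewrite !mxE !big_ord_recl big_ord0 !mxE.
case: i => [[|[|[|[|i]]]] lti] //; case: j => [[|[|[|[|j]]]] ltj] //=;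
by rewrite !(mulr0, mul0r, mulr1, addr0, add0r).
Qed.

Lemma is_sp4_tr A : is_sp4 A -> is_sp4 A^T.
Proof.
rewrite /is_sp4 trmxK => /eqP defA.
have: sp4_form *m A^T *m sp4_form *m A = 1%:M.
  by rewrite -!mulmxA (mulmxA A^T) defA sp4_form_sq.
move/mulmx1C; rewrite !mulmxA => /(congr1 (mulmx^~ sp4_form)).
by rewrite -!mulmxA sp4_form_sq mulmx1 mul1mx => ->.
Qed.

Lemma is_sp4M A B : is_sp4 A -> is_sp4 B -> is_sp4 (A *m B).
Proof.
rewrite /is_sp4 => /eqP defA /eqP defB.
by rewrite trmx_mul -!mulmxA (mulmxA A^T) (mulmxA (A^T *m _)) defA mulmxA defB.
Qed.

Lemma sp4_isogenyM A B : is_sp4 A -> is_sp4 B ->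
  sp4_isogeny (A *m B) = sp4_isogeny A *m sp4_isogeny B.
Proof.
move=> spA spB; have spA' := is_sp4_tr spA.
have sum4 (E : 'I_4 -> F) : \sum_i E i =
    E (inord 0) + E (inord 1) + E (inord 2) + E (inord 3).
  rewrite !big_ord_recl big_ord0 addr0 !addrA.
  by do !congr (_ + _); congr E; apply/val_inj; rewrite /= inordK.
have relP C (p : 'I_4) : is_sp4 C -> let c := ext2_row p in
    C (inord 0) c.1 * C (inord 3) c.2 + C (inord 1) c.1 * C (inord 2) c.2
    + C (inord 2) c.1 * C (inord 1) c.2 + C (inord 3) c.1 * C (inord 0) c.2 = 0.
  move=> /eqP/matrixP defC c; have := defC c.1 c.2.
  rewrite !mxE !sum4 !mxE !sum4 !mxE !inordK //=.
  have -> : (c.1 + c.2 == 3)%N = false.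
    by rewrite /c; case: p {c} => [[|[|[|[|p]]]] ltp]; rewrite //= !inordK.
  by move=> h; rewrite -[RHS]h; ring.
have two0 := suzuki_two0.
have core (a0 a1 a2 a3 a0' a1' a2' a3' b0 b1 b2 b3 b0' b1' b2' b3' : F) :
    a0 * a3' + a1 * a2' + a2 * a1' + a3 * a0' = 0 ->
    b0 * b3' + b1 * b2' + b2 * b1' + b3 * b0' = 0 ->
    (a0 * b0 + a1 * b1 + a2 * b2 + a3 * b3)
      * (a0' * b0' + a1' * b1' + a2' * b2' + a3' * b3')
    - (a0 * b0' + a1 * b1' + a2 * b2' + a3 * b3')
      * (a0' * b0 + a1' * b1 + a2' * b2 + a3' * b3) =
    (a0 * a1' - a1 * a0') * (b0 * b1' - b0' * b1)
    + (a0 * a2' - a2 * a0') * (b0 * b2' - b0' * b2)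
    + (a1 * a3' - a3 * a1') * (b1 * b3' - b1' * b3)
    + (a2 * a3' - a3 * a2') * (b2 * b3' - b2' * b3).
  move=> hA hB; apply/eqP; rewrite -subr_eq0; apply/eqP.
  have eA : a0 * a3' - a3 * a0' = - (a1 * a2' - a2 * a1').
    apply/eqP; rewrite -subr_eq0 -[X in _ == X](mulr0 1).
    rewrite -[X in _ == 1 * X](subrr 0) -{1}hA.
    rewrite -(mul0r (a3 * a0' + a2 * a1')) -two0; apply/eqP; ring.
  have eB : b0 * b3' - b3 * b0' = - (b1 * b2' - b2 * b1').
    apply/eqP; rewrite -subr_eq0 -[X in _ == X](mulr0 1).
    rewrite -[X in _ == 1 * X](subrr 0) -{1}hB.
    rewrite -(mul0r (b3 * b0' + b2 * b1')) -two0; apply/eqP; ring.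
  transitivity ((a0 * a3' - a3 * a0') * (b0 * b3' - b3 * b0')
                + (a1 * a2' - a2 * a1') * (b1 * b2' - b2 * b1')); first by ring.
  by rewrite eA eB mulrNN -mulr2n -mulr_natl two0 mul0r.
have mulE k l : (A *m B) k l =
    A k (inord 0) * B (inord 0) l + A k (inord 1) * B (inord 1) l +
    A k (inord 2) * B (inord 2) l + A k (inord 3) * B (inord 3) l.
  by rewrite mxE sum4.
apply/matrixP=> i j; rewrite mxE /= !mulE [RHS]mxE sum4 !mxE /=.
have := relP _ i spA'; have := relP _ j spB; rewrite /= !mxE => hB hA.
rewrite (core _ _ _ _ _ _ _ _ _ _ _ _ _ _ _ _ hA hB).
by rewrite /ext2_row !inordK.
Qed.

Lemma suzuki_group_set : group_set (suzuki_set m).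
Proof.
have sp1 : is_sp4 1%:M by rewrite /is_sp4 trmx1 mul1mx mulmx1.
apply/group_setP; split=> [|x y]; rewrite !inE.
  rewrite GL4_oneE sp1 /steinberg -/(frob4 _).
  have -> : frob4 1%:M = 1%:M.
    rewrite /frob4; apply/matrixP=> i j; rewrite !mxE.
    by case: eqP; rewrite ?expr1n // expr0n expn_eq0.
  have id1 (a b : 'I_4) : (1%:M : 'M[F]_4) a b = (a == b :> nat)%:R by rewrite mxE.
  apply/eqP/matrixP=> i j; rewrite [LHS]mxE /= !id1.
  case: i => [[|[|[|[|i]]]] lti] //; case: j => [[|[|[|[|j]]]] ltj] //=;
  by rewrite !inordK //= !(mulr0, mul0r, mulr1, subr0).
move=> /andP[spx /eqP fx] /andP[spy /eqP fy]; rewrite GL4_mulE is_sp4M //=.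
rewrite /steinberg -/(frob4 _) frob4M sp4_isogenyM; last 2 first.
- exact: frob4_sp4.
- exact: frob4_sp4.
by rewrite -[frob4 (GLval x)]/(map_mx _ _) -/(steinberg m _) -/(steinberg m _) fx fy.
Qed.
Definition suzuki : {group {'GL_4[F]}} := Group suzuki_group_set.

(* The diagonal and the lower triangular matrices of Sp_4 form a maximal      *)
(* torus and a Borel subgroup that are stable under the Steinberg             *)
(* endomorphism; these are their fixed points, and the unipotent radical.     *)
Definition suzuki_borel : {group {'GL_4[F]}} :=
  (suzuki :&: lower_triangular)%G.

Definition suzuki_unip : {group {'GL_4[F]}} :=
  (suzuki :&: lower_unitriangular)%G.

Definition suzuki_torus : {group {'GL_4[F]}} :=
  (suzuki :&: diagonal)%G.

End Matrices.

(* Main.v *)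
(** The group G = Sz(q) has a split BN-pair of rank 1 with B = U ><| T a Frobenius
group of index q^2 + 1. By Mackey's formula, the Harish-Chandra induced characters
of the nontrivial characters t of T are irreducible and coincide for t and t^-1
only, which yields q/2 - 1 irreducible characters of degree q^2 + 1, and the
trivial character of T yields 1 + St with St(1) = q^2. All other constituents
come from the three irreducible characters of B that are nontrivial on U, of
degrees q - 1, (q - 1)d and (q - 1)d with q = 2d^2. Mackey's formula gives the
Gram matrix of the induced characters, and the first one is multiplicity-free
(Gelfand-Graev). Together with the divisibility of |G| by the degrees, this forces
the other q/2 + 2 irreducible characters to have degrees (q - 1)d and
(q - 1)(q + 1 +- 2d).

If chi is induced from a character of H < G, then |G : H| divides chi(1), while
|G : H| - 1 is a sum of degrees of nontrivial irreducible characters, because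
the permutation character on G / H contains the trivial character once. This
leaves only chi(1) = q^2 + 1, and |G : H| = q^2 with chi(1) = q^2. In the latter case
H has odd order but, up to conjugation, contains T and the involution w.

The library only knows characters over algC. All irreducible representations of
the subgroups of G are realized over one number field L, and characters move from
algC to K through the embeddings of L into both. *)

From HB Require Import structures.
Require Import Defs.
From mathcomp Require Import all_boot all_order all_algebra.
From mathcomp Require Import all_fingroup all_solvable all_field all_character.
From mathcomp Require Import zify ring.

Set Implicit Arguments.
Unset Strict Implicit.
Unset Printing Implicit Defensive.

Import GroupScope Order.TTheory GRing.Theory Num.Theory.
Local Open Scope ring_scope.

(** * An arithmetic lemma on Gram matrices *)

(** The number of classes of G is never computed: the only class count is that of B, which is q + 2,
    and |Irr(G)| comes out of the count of the cuspidal characters. Write the degree of a cuspidal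
    character as (q - 1)k. The Gram matrix is turned into an inequality between norms, and
    divisibility of |G| enters to exclude k = q + 1 and k = q + 1 + d or q + 1 - d. Arithmetic alone
    cannot exclude a subgroup of index q^2, because q^2 - 1 = (q - 1)(q + 1 - 2d) + 2(q - 1)d is
    itself a sum of nontrivial degrees; hence the separate group-theoretic argument for this index.
    The character theory sees Sz(q) only through two records, [split_rank_one] and [suzuki_like], so
    matrices occur only where these are verified. The assumption m >= 1 makes the field larger than
    F_2: then T is nontrivial, and the derived subgroup of U contains all squares, which makes the
    linear characters of U real. *)

Lemma sum_sqr_eq0 (I : finType) (P : {set I}) (f : I -> int) :
  \sum_(i in P) f i ^+ 2 = 0 -> forall i, i \in P -> f i = 0.
Proof.
move=> /eqP; rewrite psumr_eq0 => [/allP f0 i Pi|i _]; last exact: sqr_ge0.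
by have /implyP/(_ Pi) := f0 i (mem_index_enum i); rewrite sqrf_eq0 => /eqP.
Qed.

(** A nonzero integral square below 4 is 1, so a term equal to 1 can be split off. Applied twice to
    a vector of norm 2, this finds its two nonzero entries. *)
Lemma sum_sqr_pick (I : finType) (P : {set I}) (f : I -> int) (n : int) :
    \sum_(i in P) f i ^+ 2 = n -> 0 < n < 4 ->
  exists2 i, i \in P & f i ^+ 2 = 1 /\ \sum_(j in P :\ i) f j ^+ 2 = n - 1.
Proof.
move=> sumf /andP[n_gt0 n_lt4].
have [i Pi nz_fi] : exists2 i, i \in P & f i != 0.
  apply/exists_inP; case: exists_inP => // f0.
  move: n_gt0; rewrite -sumf big1 ?ltxx // => i Pi.
  by case: (eqVneq (f i) 0) => [->|nz]; [rewrite expr0n | case: f0; exists i].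
have := sumf; rewrite (bigD1 i) //= => def_n.
have ge0 : 0 <= \sum_(j in P | j != i) f j ^+ 2 by apply: sumr_ge0 => j _; exact: sqr_ge0.
have fi1 : f i ^+ 2 = 1.
  move: n_lt4 ge0 nz_fi; rewrite -def_n.
  move: (f i) (\sum_(_ in _ | _) _) => x y; rewrite expr2 => xxy y_ge0 /eqP nz_x.
  have [?|[->//|[->//|?]]] : x <= - 2 \/ x = - 1 \/ x = 1 \/ 2 <= x by lia.
    by nia.
  by nia.
exists i => //; split=> //.
rewrite -def_n fi1 addrC addrK; apply: eq_bigl => j.
by rewrite in_setD1 andbC.
Qed.

(* The a i, b1 i, b2 i are the multiplicities of the i-th cuspidal character in
   the characters induced from the three characters of the Borel subgroup that
   are not trivial on its unipotent radical; its degree is (q - 1) * k i. *)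
Section GramSolution.

Variables (d : nat) (I : finType) (C : {set I}) (a b1 b2 : I -> nat).
Let q := (2 * d ^ 2)%N.
Let k i := (a i + d * (b1 i + b2 i))%N.
Hypotheses (d_gt1 : (1 < d)%N) (d_even : ~~ odd d).
Hypotheses (aa : (\sum_(i in C) a i * a i = d ^ 2)%N).
Hypotheses (ab1 : (\sum_(i in C) a i * b1 i = d * (d ^ 2 - 1))%N).
Hypotheses (ab2 : (\sum_(i in C) a i * b2 i = d * (d ^ 2 - 1))%N).
Hypotheses (b11 : (\sum_(i in C) b1 i * b1 i = 1 + (d ^ 2 - 1) * d ^ 2)%N).
Hypotheses (b22 : (\sum_(i in C) b2 i * b2 i = 1 + (d ^ 2 - 1) * d ^ 2)%N).
Hypotheses (b12 : (\sum_(i in C) b1 i * b2 i = (d ^ 2 - 1) * d ^ 2)%N).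
Hypotheses (a_le1 : {in C, forall i, a i <= 1}%N).
Hypotheses (k_gt0 : {in C, forall i, 0 < k i}%N).
Hypotheses (k_dvd : {in C, forall i, k i %| q ^ 2 * (q ^ 2 + 1)}%N).

Let zsum (f g : I -> nat) :
  \sum_(i in C) (f i)%:Z * (g i)%:Z = (\sum_(i in C) f i * g i)%N%:Z.
Proof.
by rewrite (big_morph Posz PoszD (erefl _)); apply: eq_bigr => i _; rewrite PoszM.
Qed.

Let coprime_qE k' : (coprime k' d -> odd k' -> k' %| q ^ 2 * (q ^ 2 + 1) -> k' %| q ^ 2 + 1)%N.
Proof.
move=> co_d odd_k; rewrite Gauss_dvdr // coprimeXr // coprimeMr coprimen2 odd_k.
by rewrite coprimeXr.
Qed.

Let ndvd_q1 : ~~ (q + 1 %| q ^ 2 * (q ^ 2 + 1))%N.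
Proof.
apply/negP; rewrite Gauss_dvdr; last by rewrite coprimeXr // addn1 coprimeSn.
have -> : (q ^ 2 + 1 = (q - 1) * (q + 1) + 2)%N by move: d_gt1; rewrite /q; clear; nia.
rewrite dvdn_addr ?dvdn_mull // => /dvdn_leq => /(_ isT).
by move: d_gt1; rewrite /q; clear; nia.
Qed.

(** As q = 2d^2, the product (q + 1 + d)(q + 1 - d) equals q^2 + 1 + 3d^2. The factor [k'] is odd
    and 1 modulo [d], so it would divide q^2 + 1, hence 3d^2, hence 3. *)
Let ndvd_qd k' : (k' = q + 1 + d)%N \/ (k' + d = q + 1)%N ->
  ~~ (k' %| q ^ 2 * (q ^ 2 + 1))%N.
Proof.
move=> def_k; apply/negP=> dvd_k.
have [e def_d] : exists e, d = e.+1 by exists d.-1; rewrite prednK // ltnW.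
have def_q : q = (2 * e.+1 * e.+1)%N by rewrite /q def_d; ring.
have [k2 def_kk] : exists k2, (k' * k2 = q ^ 2 + 1 + 3 * d ^ 2)%N.
  case: def_k => def_k; first exists (2 * e * e + 3 * e + 2)%N.
    by rewrite def_k def_q def_d; ring.
  exists (q + 1 + d)%N; have -> : (k' = 2 * e * e + 3 * e + 2)%N by move: def_k; rewrite def_q def_d; clear; lia.
  by rewrite def_q def_d; ring.
have [k3 def_k3] : exists k3, (k' = d * k3 + 1)%N.
  case: def_k => def_k; first exists (2 * d + 1)%N.
    by rewrite def_k /q; ring.
  exists (2 * e + 1)%N; have -> : (k' = 2 * e * e + 3 * e + 2)%N by move: def_k; rewrite def_q def_d; clear; lia.
  by rewrite def_d; ring.
have co_d : coprime k' d.
  by rewrite def_k3 /coprime gcdnC mulnC gcdnMDl gcdn1.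
have odd_k : odd k' by rewrite def_k3 oddD oddM (negPf d_even).
have := coprime_qE co_d odd_k dvd_k => dvd_k1.
have : (k' %| 3 * d ^ 2)%N by rewrite -(dvdn_addr _ dvd_k1) -def_kk dvdn_mulr.
rewrite Gauss_dvdl ?coprimeXr // => /dvdn_leq => /(_ isT).
by move: def_k d_gt1; rewrite def_q def_d; clear; nia.
Qed.

(** The vector [b1 - b2] has norm 2, so it has two nonzero entries, at [x] and [y]. They have
    opposite signs because [b1] and [b2] have equal norms, and [a x = a y] because [a] is orthogonal
    to [b1 - b2]. The values at [x] and [y] yield the two cuspidal characters with [k = d], all
    other places those with k = q + 1 - 2d or q + 1 + 2d. *)
Lemma gram_solution :
  #|C| = (d ^ 2 + 2)%N /\
  {in C, forall i, [\/ k i = d, k i + 2 * d = q + 1 | k i = q + 1 + 2 * d]%N}.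
Proof.
have [i Ci [Di sumD1]] : exists2 i, i \in C &
    ((b1 i)%:Z - (b2 i)%:Z) ^+ 2 = 1 /\
    \sum_(j in C :\ i) ((b1 j)%:Z - (b2 j)%:Z) ^+ 2 = 2 - 1.
  apply: sum_sqr_pick => //.
  under eq_bigr => j _ do rewrite expr2 mulrBl !mulrBr.
  have b21 : (\sum_(j in C) b2 j * b1 j = (d ^ 2 - 1) * d ^ 2)%N.
    by rewrite -b12; apply: eq_bigr => j _; rewrite mulnC.
  by rewrite !sumrB !zsum b11 b22 b12 b21; move: (_ * _)%N => x; clear; lia.
have [j C'j [Dj sumD0]] := sum_sqr_pick sumD1 isT.
have [neq_ji Cj] := setD1P C'j.
have D0 := sum_sqr_eq0 sumD0.
pose O := C :\ i :\ j.
have b12_O l : l \in O -> b1 l = b2 l by move/D0=> /eqP; rewrite subr_eq0 => /eqP[].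
have C_O (f : I -> nat) : (\sum_(l in C) f l = f i + f j + \sum_(l in O) f l)%N.
  by rewrite (big_setD1 i) // (big_setD1 j) //= addnA.
have Di' : b1 i = (b2 i + 1)%N \/ b2 i = (b1 i + 1)%N.
  by move: (b1 i) (b2 i) Di => x y; rewrite expr2; clear; nia.
have Dj' : b1 j = (b2 j + 1)%N \/ b2 j = (b1 j + 1)%N.
  by move: (b1 j) (b2 j) Dj => x y; rewrite expr2; clear; nia.
have O_eq (f : I -> nat) : (\sum_(l in O) f l * b1 l = \sum_(l in O) f l * b2 l)%N.
  by apply: eq_bigr => l /b12_O->.
have O_eq' : (\sum_(l in O) b2 l * b2 l = \sum_(l in O) b1 l * b2 l)%N.
  by apply: eq_bigr => l /b12_O->.
have [x [y [xyP ayx b1x b1y b2y]]] : exists x y,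
    [/\ x = i /\ y = j \/ x = j /\ y = i, a x = a y, b1 x = (b2 x + 1)%N,
      b1 y = b2 x & b2 y = b1 x].
  move: ab1 ab2 b11 b22 b12; rewrite !C_O (O_eq a) (O_eq b1) O_eq' => e1 e2 e3 e4 e5.
  have {}e1 : (a i * b1 i + a j * b1 j = a i * b2 i + a j * b2 j)%N.
    by move: e1 e2; clear; lia.
  have {}e3 : (b1 i * b1 i + b1 j * b1 j = b1 i * b2 i + b1 j * b2 j + 1)%N.
    by move: e3 e5; clear; lia.
  have {}e4 : (b2 i * b2 i + b2 j * b2 j = b1 i * b2 i + b1 j * b2 j + 1)%N.
    by move: e4 e5; clear; lia.
  clear -e1 e3 e4 Di' Dj'.
  case: Di' e1 e3 e4 => Ei; case: Dj' => Ej; rewrite ?Ei ?Ej => e1 e3 e4;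
    [nia | exists i, j | exists j, i | nia].
  - split; first [by auto | nia].
  - split; first [by auto | nia].
have {}C_O (f : I -> nat) : (\sum_(l in C) f l = f x + f y + \sum_(l in O) f l)%N.
  by rewrite C_O; case: xyP => -[-> ->] //; rewrite (addnC (f j)).
have Cx : x \in C by case: xyP => -[-> _].
have defO l : l \in C -> [\/ l = x, l = y | l \in O].
  move=> Cl; rewrite !inE Cl andbT; case: (eqVneq l i) (eqVneq l j) => [->|?] [->|?];
  by case: xyP => -[-> ->]; by [constructor 1|constructor 2|constructor 3].
have cardC : #|C| = (2 + #|O|)%N by rewrite -!sum1_card C_O.
have O_C l : l \in O -> l \in C by rewrite !inE => /and3P[].
move: O O_C b12_O C_O defO cardC {O_eq O_eq'} => O O_C b12_O C_O defO cardC.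
clear i j Ci Di Dj neq_ji Cj xyP Di' Dj' sumD1 C'j sumD0 D0.
set a0 := a x; set b0 := b2 x.
(* For l in O, c l ^ 2 >= 1 >= a l ^ 2, while the prescribed Gram matrix bounds
   the sum of the c l ^ 2 by that of the a l ^ 2, up to a term in a0 and b0. *)
pose c l := d%:Z * (a l)%:Z - (b2 l)%:Z.
have c_neq0 l : l \in O -> 1 <= c l ^+ 2.
  move=> Ol; have : c l != 0.
    (* If [c l = 0], then k = (q + 1) [a l], which is 0 or the excluded value q + 1. *)
    apply/negP=> /eqP c0; have Cl := O_C l Ol.
    have := k_dvd Cl; have := k_gt0 Cl; have := a_le1 Cl.
    rewrite /k b12_O //; have {}c0 : (b2 l = d * a l)%N by move: c0; rewrite /c; clear; lia.
    rewrite c0; case: (a l) => [|[|//]] _; rewrite ?muln0 //.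
    have -> : (1 + d * (d * 1 + d * 1) = q + 1)%N by rewrite /q; clear; lia.
    by move=> _; apply/negP.
  by move: (c l) => t; rewrite expr2; clear; nia.
have sumO (f g : I -> nat) :
    \sum_(l in O) (f l)%:Z * (g l)%:Z = (\sum_(l in O) f l * g l)%N%:Z.
  by rewrite (big_morph Posz PoszD (erefl _)); apply: eq_bigr => l _; rewrite PoszM.
have Ay : a y = a0 by rewrite -ayx.
have B1 : b2 y = (b0 + 1)%N by rewrite b2y b1x.
have sum_a2 : \sum_(l in O) (a l)%:Z ^+ 2 = d%:Z ^+ 2 - 2 * a0%:Z ^+ 2.
  under eq_bigr => l _ do rewrite expr2; rewrite sumO.
  move: aa; rewrite C_O Ay -/a0 => e.
  by move: e; rewrite -mulnn !expr2; clear; lia.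
have sum_ab : \sum_(l in O) (a l)%:Z * (b2 l)%:Z =
    d%:Z * (d%:Z ^+ 2 - 1) - a0%:Z * (2 * b0%:Z + 1).
  rewrite sumO; move: d_gt1 ab2; rewrite C_O Ay -/a0 B1 -/b0 -mulnn !expr2.
  case: (d) => [//|e _]; have -> : (e.+1 * e.+1 - 1 = e * e + 2 * e)%N by clear; nia.
  by clear; nia.
have sum_b2 : \sum_(l in O) (b2 l)%:Z ^+ 2 =
    (d%:Z ^+ 2 - 1) * d%:Z ^+ 2 - 2 * (b0%:Z ^+ 2 + b0%:Z).
  under eq_bigr => l _ do rewrite expr2; rewrite sumO.
  move: d_gt1 b22; rewrite C_O B1 -/b0 -mulnn !expr2.
  case: (d) => [//|e _]; have -> : (e.+1 * e.+1 - 1 = e * e + 2 * e)%N by clear; nia.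
  by clear; nia.
have sum_c2 : \sum_(l in O) c l ^+ 2 =
    d%:Z ^+ 2 - 2 * ((d%:Z * a0%:Z - b0%:Z) ^+ 2 - (d%:Z * a0%:Z - b0%:Z)).
  transitivity (d%:Z ^+ 2 * \sum_(l in O) (a l)%:Z ^+ 2
     - 2 * d%:Z * (\sum_(l in O) (a l)%:Z * (b2 l)%:Z) + \sum_(l in O) (b2 l)%:Z ^+ 2).
    rewrite !mulr_sumr -sumrB -big_split /=; apply: eq_bigr => l _.
    by rewrite /c; ring.
  by rewrite sum_a2 sum_ab sum_b2; ring.
have ge0 l : l \in O -> 0 <= c l ^+ 2 - (a l)%:Z ^+ 2.
  move=> Ol; have := c_neq0 l Ol; have := a_le1 (O_C l Ol).
  by case: (a l) => [|[|//]] _; rewrite ?expr1n ?expr0n /=; lia.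
have sumd : \sum_(l in O) (c l ^+ 2 - (a l)%:Z ^+ 2) =
    2 * a0%:Z ^+ 2 - 2 * ((d%:Z * a0%:Z - b0%:Z) ^+ 2 - (d%:Z * a0%:Z - b0%:Z)).
  by rewrite sumrB sum_c2 sum_a2; ring.
have : 0 <= 2 * a0%:Z ^+ 2 - 2 * ((d%:Z * a0%:Z - b0%:Z) ^+ 2 - (d%:Z * a0%:Z - b0%:Z)).
  by rewrite -sumd; apply: sumr_ge0.
have kx : k x = (a0 + d * (2 * b0 + 1))%N by rewrite /k b1x -/a0 -/b0; ring.
have := a_le1 Cx; rewrite -/a0; case: (posnP a0) => [a00 _ | a0_gt0 a0_le1]; last first.
  (* The bound now leaves d - b0 = 0 or 1, that is, k = q + 1 + d or q + 1 - d at [x]. *)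
  have a01 : a0 = 1%N by lia.
  rewrite a01 !expr2 => ge0'.
  suff /negP[]: ~~ (k x %| q ^ 2 * (q ^ 2 + 1))%N by exact: k_dvd.
  rewrite kx a01; apply: ndvd_qd.
  rewrite /q; move: ge0' d_gt1; move: (d) (b0) => e b; rewrite -mulnn; clear => h1 h2.
  have : e = b \/ e = (b + 1)%N by nia.
  by case=> ->; [left | right]; nia.
rewrite a00 => ge0'; have b00 : b0 = 0%N.
  by move: ge0'; rewrite !expr2; move: (b0) => b; clear; nia.
have {}sumd : \sum_(l in O) (c l ^+ 2 - (a l)%:Z ^+ 2) = 0.
  by rewrite sumd a00 b00 !expr2; clear; lia.
have aO l : l \in O -> a l = 1%N /\ c l ^+ 2 = 1.
  move=> Ol; have := sumd; move/eqP; rewrite psumr_eq0 // => /allP/(_ l (mem_index_enum l)).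
  rewrite Ol /= => /eqP; have := c_neq0 l Ol; have := a_le1 (O_C l Ol).
  by case: (a l) => [|[|//]] _ cge1; rewrite ?expr1n ?expr0n /= => e0; split=> //; lia.
split.
  have cO : \sum_(l in O) (a l)%:Z ^+ 2 = #|O|%:Z.
    under eq_bigr => l Ol do rewrite (aO l Ol).1 expr1n.
    by rewrite sumr_const natz.
  by move: sum_a2; rewrite cO a00 cardC -mulnn expr2; clear; lia.
move=> l Cl; case: (defO l Cl) => [->|->|Ol].
- by constructor 1; rewrite kx a00 b00; clear; lia.
- by constructor 1; rewrite /k Ay b1y B1 -/b0 a00 b00; clear; lia.
have [al1 /eqP] := aO l Ol; rewrite sqrf_eq1 => /orP[] /eqP cl;
  [constructor 2 | constructor 3]; rewrite /k b12_O // al1; move: cl;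
  by rewrite /c al1 /q -mulnn; clear; nia.
Qed.

End GramSolution.

(** * Split BN-pairs of rank 1 *)

Lemma involV (gT : finGroupType) (w : gT) : (w * w = 1)%g -> w^-1%g = w.
Proof. by move=> w2; apply/eqP; rewrite eq_invg_mul w2. Qed.

(* The corner ring of an idempotent matrix E is commutative only if E has rank at
   most 1; the conclusion is the trace form of this. *)
Lemma mxtrace_comm_corner (R : comNzRingType) n (E : 'M[R]_n) :
    E *m E = E -> (forall M N, E *m M *m E *m N *m E = E *m N *m E *m M *m E) ->
  \tr E ^+ 3 = \tr E.
Proof.
move=> idE cEE.
have deltaE (A B : 'M[R]_n) i j x y : (A *m delta_mx i j *m B) x y = A x i * B j y.
  rewrite mxE (bigD1 j) //= big1 ?addr0 => [|z ne_zj].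
    rewrite mxE (bigD1 i) //= big1 ?addr0 ?mxE ?eqxx ?mulr1 // => z ne_zi.
    by rewrite mxE (negPf ne_zi) mulr0.
  by rewrite mxE big1 ?mul0r // => t _; rewrite mxE (negPf ne_zj) andbF mulr0.
have e3M x y i j k l :
    (E *m delta_mx i j *m E *m delta_mx k l *m E) x y = E x i * E j k * E l y.
  by rewrite deltaE deltaE.
have e3 x y j k l i : E x i * E j k * E l y = E x k * E l i * E j y.
  by rewrite -e3M cEE e3M.
suff defE : \tr E ^+ 2 *: E = E by rewrite -{2}defE mxtraceZ -exprSr.
have idE3 : E *m E *m E = E by rewrite !idE.
apply/matrixP=> l y; rewrite mxE -[in RHS]idE3 mxE expr2.
rewrite {2}/mxtrace mulr_sumr mulr_suml; apply: eq_bigr => j _.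
rewrite {1}/mxtrace !mulr_suml mxE mulr_suml; apply: eq_bigr => x _.
by rewrite (e3 x y j j l x) [E x j * _]mulrC.
Qed.

(* A split BN-pair of rank 1 whose torus is inverted by the Weyl involution and
   acts without fixed points on the unipotent radical, as in SL_2(2^n) and Sz(q). *)
Record split_rank_one (gT : finGroupType) (G B U T : {group gT}) (w : gT) : Prop :=
  SplitRankOne {
    rk1_sub : B \subset G;
    rk1_Frobenius : [Frobenius B = U ><| T];
    rk1_bruhat : {in G, forall g, g \notin B ->
      exists b u, [/\ b \in B, u \in U & g = b * w * u]%g};
    rk1_mem : w \in G;
    rk1_invol : (w * w = 1)%g;
    rk1_inv : {in T, forall t, t ^ w = t^-1}%g;
    rk1_torus : B :&: B :^ w = T
  }.

Section GelfandGraev.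

Variables (gT : finGroupType) (G B U T : {group gT}) (w : gT).
Hypothesis rk1 : split_rank_one G B U T w.

(* If E is the idempotent of the real linear character s of U, then x |-> x^-1
   fixes every E g E by the Bruhat decomposition, since w inverts T. This
   anti-automorphism makes the Hecke algebra E K[G] E commutative. *)
Lemma gelfand_graev i (s : Iirr U) :
    s != 0 -> 'chi_s \is a linear_char ->
    {in U, forall u, 'chi_s u^-1%g = 'chi_s u} ->
  '['Res[U] 'chi[G]_i, 'chi_s] <= 1.
Proof.
have [sBG frobB bruhat Gw w2 invT _] := rk1; move=> nz_s lin_s real_s.
have [defB _ _ /andP[sUB _] /andP[sTB _]] := Frobenius_context frobB.
have [_ _ nUT _] := sdprodP defB.
have sUG := subset_trans sUB sBG.
have irrG : mx_irreducible 'Chi_i := socle_irr _.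
have := irrRepr i; move: 'Chi_i irrG => rG irrG chiE; pose th := 'chi_s.
have th_sq u : u \in U -> th u * th u = 1.
  move=> Uu; rewrite -{1}real_s // -lin_charM ?groupV // mulVg.
  exact: lin_char1.
have [E defE] : exists E, E = #|U|%:R^-1 *: \sum_(u in U) th u *: rG u by eexists.
have UG u : u \in U -> u \in G by move/(subsetP sUG).
have TG t : t \in T -> t \in G by move/(subsetP (subset_trans sTB sBG)).
have EU u : u \in U -> E *m rG u = th u *: E.
  move=> Uu; rewrite defE -scalemxAl mulmx_suml scalerA mulrC -scalerA; congr (_ *: _).
  rewrite scaler_sumr (reindex_inj (mulIg u^-1%g)) /=.
  apply: eq_big => [v | v]; rewrite groupMr ?groupV // => Uv.
  rewrite -scalemxAl -repr_mxM ?UG ?groupM ?groupV // mulgKV scalerA mulrC.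
  by rewrite lin_charM ?groupV // /th real_s // mulrC.
have UE u : u \in U -> rG u *m E = th u *: E.
  move=> Uu; rewrite defE -scalemxAr mulmx_sumr scalerA mulrC -scalerA; congr (_ *: _).
  rewrite scaler_sumr (reindex_inj (mulgI u^-1%g)) /=.
  apply: eq_big => [v | v]; rewrite groupMl ?groupV // => Uv.
  rewrite -scalemxAr -repr_mxM ?UG ?groupM ?groupV // mulKVg scalerA.
  by rewrite lin_charM ?groupV // /th real_s // mulrC.
have EE : E *m E = E.
  rewrite {2}defE -scalemxAr mulmx_sumr.
  under eq_bigr => u Uu do rewrite -scalemxAr EU // scalerA th_sq // scale1r.
  by rewrite sumr_const -scaler_nat scalerA mulVf ?scale1r ?neq0CG.
have trE : \tr E = '['Res[U] 'chi_i, 'chi_s].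
  rewrite defE mxtraceZ raddf_sum cfdotE; congr (_ * _); apply: eq_bigr => u Uu /=.
  rewrite mxtraceZ cfResE // -chiE cfunE UG // mulr1n mulrC; congr (_ * _).
  by rewrite -lin_charV_conj // real_s.
(* The inertia group of a nontrivial character of a Frobenius kernel is the kernel, so [t] moves
   [th] at some [u]. Evaluating E on both sides of u t = t u^t then gives two different multiples of
   E t E. *)
have T0 t : t \in T -> t != 1%g -> E *m rG t *m E = 0.
  move=> Tt nt_t.
  have [u Uu ne_th] : exists2 u, u \in U & th (u ^ t)%g != th u.
    apply/exists_inP; apply: contraR nt_t => /exists_inPn eq_th.
    have [_ _ _ tiUT] := sdprodP defB.
    have frobBU : [Frobenius B with kernel U] by apply/existsP; exists T.
    have nUt : t \in 'N(U) by rewrite (subsetP nUT).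
    rewrite -in_set1 -set1gE -tiUT inE Tt andbT.
    rewrite -(inertia_Frobenius_ker frobBU nz_s) inE (subsetP sTB) //= inE nUt /=.
    apply/eqP/cfun_inP=> x Ux; rewrite cfConjgE //.
    have Uxt : (x ^ t^-1)%g \in U by rewrite memJ_norm ?groupV.
    by have := eq_th _ Uxt; rewrite conjgKV negbK => /eqP.
  apply/eqP; have : (th (u ^ t)%g - th u) *: (E *m rG t *m E) = 0.
    have [Gu Gt] := (UG u Uu, TG t Tt).
    have Uut : (u ^ t)%g \in U by rewrite memJ_norm // (subsetP nUT).
    apply/eqP; rewrite scalerBl subr_eq0.
    have <- : E *m rG (u * t)%g *m E = th u *: (E *m rG t *m E).
      by rewrite repr_mxM // mulmxA EU // -!scalemxAl.
    rewrite conjgC repr_mxM ?(UG (u ^ t)%g) // -!mulmxA (UE _ Uut) //.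
    by rewrite -!scalemxAr.
  by move/eqP; rewrite scaler_eq0 subr_eq0 (negPf ne_th).
have EutE u x v : u \in U -> v \in U -> x \in G ->
    E *m rG (u * x * v)%g *m E = (th u * th v) *: (E *m rG x *m E).
  move=> Uu Uv Gx; have [Gu Gv] := (UG u Uu, UG v Uv).
  rewrite !repr_mxM ?groupM // !mulmxA EU // -!mulmxA UE //.
  by rewrite -!scalemxAr -!scalemxAl scalerA [th v * _]mulrC mulmxA.
have EgV g : g \in G -> E *m rG g *m E = E *m rG g^-1%g *m E.
  move=> Gg; have [Bg | B'g] := boolP (g \in B).
    have [u [t [Uu Tt -> _]]] := mem_sdprod defB Bg.
    have Gt := TG t Tt; rewrite -[(u * t)%g]mulg1 EutE // !invMg invg1 mul1g.
    rewrite -[(t^-1 * u^-1)%g]mul1g mulgA EutE ?groupV //.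
    have [->|nt_t] := eqVneq t 1%g; first by rewrite invg1 /th real_s // mulrC.
    by rewrite !T0 ?groupV ?eq_invg1 // !scaler0.
  have [b [v [Bb Uv ->]]] := bruhat g Gg B'g.
  have [u [t [Uu Tt -> _]]] := mem_sdprod defB Bb.
  have -> : ((u * t * w * v)^-1 = v^-1 * (t * w) * u^-1)%g.
    rewrite !invMg -!mulgA; congr (_ * _)%g; rewrite !mulgA; congr (_ * _)%g.
    by rewrite involV // -(invT t Tt) conjgE involV // !mulgA w2 mul1g.
  rewrite -(mulgA u) !EutE ?groupV ?groupM ?(TG t) //.
  by rewrite /th !real_s // mulrC.
have EghE g h : g \in G -> h \in G -> E *m rG g *m E *m rG h *m E =
    #|U|%:R^-1 *: \sum_(u in U) th u *: (E *m rG (g * u * h)%g *m E).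
  move=> Gg Gh; rewrite -3!mulmxA {2}defE -scalemxAl mulmx_suml -scalemxAr mulmx_sumr.
  rewrite -scalemxAr mulmx_sumr; congr (_ *: _); apply: eq_bigr => u Uu.
  have Gu := UG u Uu.
  by rewrite -!scalemxAl -!scalemxAr !repr_mxM ?groupM // !mulmxA.
have EAB A A' : E *m A *m E *m A' *m E = (E *m A *m E) *m (E *m A' *m E).
  by rewrite !mulmxA -[in RHS](mulmxA _ E E) EE.
have comm g h : g \in G -> h \in G ->
   E *m rG g *m E *m rG h *m E = E *m rG h *m E *m rG g *m E.
  move=> Gg Gh; rewrite EghE // [RHS]EAB (EgV h) // (EgV g) // -EAB EghE ?groupV //.
  congr (_ *: _); rewrite (reindex_inj invg_inj) /=.
  apply: eq_big => [u | u]; rewrite groupV // => Uu; have Gu := UG u Uu.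
  by rewrite /th real_s // EgV ?groupM ?groupV // !invMg invgK mulgA.
(* By absolute irreducibility every matrix is a combination of the [rG x], so commutativity passes
   from group elements to the whole corner ring. *)
have /mx_abs_irrP[_ [a def_a]] : mx_absolutely_irreducible rG.
  exact: groupC.
have : \tr E ^+ 3 = \tr E.
  have commM M h : h \in G ->
      E *m M *m E *m rG h *m E = E *m rG h *m E *m M *m E.
    move=> Gh; rewrite (def_a M) !(mulmx_sumr, mulmx_suml).
    by apply: eq_bigr => x Gx; rewrite -!(scalemxAr, scalemxAl) comm.
  apply: mxtrace_comm_corner => // M N; rewrite (def_a N) !(mulmx_sumr, mulmx_suml).
  by apply: eq_bigr => x Gx; rewrite -!(scalemxAr, scalemxAl) commM.
rewrite -trE; have /natrP[c ->] : \tr E \in Num.nat.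
  by rewrite trE Cnat_cfdot_char ?cfRes_char ?irr_char.
case: c => [|c]; rewrite ?ler01 // => /eqP.
rewrite -natrX eqr_nat expnS -[X in _ == X]muln1 eqn_pmul2l // -(exp1n 2) eqn_exp2r //.
by move/eqP->.
Qed.

End GelfandGraev.

Section SplitRankOne.

Variables (gT : finGroupType) (G B U T : {group gT}) (w : gT).
Hypothesis rk1 : split_rank_one G B U T w.

Let sBG := rk1_sub rk1.
Let frobB := rk1_Frobenius rk1.
Let bruhat := rk1_bruhat rk1.
Let Gw := rk1_mem rk1.
Let w2 := rk1_invol rk1.
Let invT := rk1_inv rk1.
Let tiBw := rk1_torus rk1.

Let defB : U ><| T = B. Proof. by case/Frobenius_context: frobB. Qed.
Let sUB : U \subset B. Proof. by case/sdprodW/mulG_sub: defB. Qed.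
Let sTB : T \subset B. Proof. by case/sdprodW/mulG_sub: defB. Qed.
Let tiUT : U :&: T = 1%g. Proof. by case/sdprodP: defB. Qed.
Let cardB : (#|B| = #|U| * #|T|)%N. Proof. by rewrite (sdprod_card defB). Qed.

Let wV : w^-1%g = w := involV w2.

Lemma notin_w : w \notin B.
Proof.
apply/negP=> Bw; have [_ ntU _ _ /properP[_ [x Bx /negP[]]]] := Frobenius_context frobB.
by rewrite -tiBw inE Bx conjGid.
Qed.

Lemma big_cell : G :\: B = (B :* w * U)%g.
Proof.
apply/setP=> g; rewrite inE; apply/andP/mulsgP=> [[B'g Gg] | [bw u]].
  have [b [u [Bb Uu ->]]] := bruhat Gg B'g.
  by exists (b * w)%g u; rewrite // mem_rcoset mulgK.
rewrite mem_rcoset wV => Bb Uu ->; have Bu := subsetP sUB u Uu.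
have def_bw : (bw = (bw * w) * w)%g by rewrite -mulgA w2 mulg1.
have [Gu Gbw] := (subsetP sBG u Bu, subsetP sBG _ Bb).
split; last by rewrite def_bw (groupM (groupM Gbw Gw) Gu).
by rewrite def_bw groupMr // groupMl // notin_w.
Qed.

(** The factor [B :^ w] meets [U] inside B :&: B :^ w = T, hence trivially, so products in the big
    cell are unique. *)
Lemma card_big_cell : #|G :\: B| = (#|B| * #|U|)%N.
Proof.
have -> : G :\: B = (w *: (B :^ w * U))%g.
  by rewrite big_cell conjsgE !mulgA mulg_set1 mulgV mul1g.
rewrite card_lcoset TI_cardMg ?cardJg //; apply/trivgP; rewrite -tiUT subsetI subsetIr.
by rewrite -tiBw subsetI subsetIl andbT subIset ?sUB ?orbT.
Qed.

Lemma card_rank1 : #|G| = (#|B| * #|U|.+1)%N.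
Proof. by rewrite -(cardsID B G) (setIidPr sBG) card_big_cell mulnS. Qed.

Lemma index_rank1 : #|G : B| = #|U|.+1.
Proof. by rewrite -divgS // card_rank1 mulKn. Qed.

(** The inner sum [S g] depends only on the double coset of [g], and there are two. On B it gives
    the inner product in B; at [w] its terms live on B :&: B :^ w = T, where conjugation by [w] is
    inversion. *)
Lemma mackey_rank1 (phi psi : 'CF(B)) :
  '['Ind[G] phi, 'Ind[G] psi] =
  '[phi, psi] + #|T|%:R^-1 * \sum_(t in T) phi (t^-1)%g * (psi t)^*.
Proof.
pose S g := \sum_(b in B) phi (b ^ g)%g * (psi b)^*.
have S_B g : g \in B -> S g = #|B|%:R * '[phi, psi].
  move=> Bg; rewrite cfdotE mulVKf ?neq0CG //; apply: eq_bigr => b Bb.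
  by rewrite cfunJ.
have S_w g : g \in G :\: B -> S g = \sum_(t in T) phi (t^-1)%g * (psi t)^*.
  rewrite big_cell => /mulsgP[bw u]; rewrite mem_rcoset wV.
  set b0 := (bw * w)%g => Bb0 Uu ->; have Bu := subsetP sUB u Uu.
  have def_bw : (bw = b0 * w)%g by rewrite -mulgA w2 mulg1.
  move: b0 Bb0 def_bw => b0 Bb0 def_bw; transitivity (S w).
    rewrite {1}/S (reindex_inj (conjg_inj b0^-1%g)) /=.
    apply: eq_big => [b | b]; rewrite groupJr ?groupV // => Bb.
    by rewrite def_bw !conjgM conjgKV (cfunJ phi _ Bu) (cfunJ psi _ (groupVr Bb0)).
  rewrite /S (big_setID T) /= (setIidPr sTB) [X in _ + X]big1 ?addr0 => [|b].
    by apply: eq_bigr => t Tt; rewrite invT.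
  case/setDP=> Bb T'b; rewrite cfun0 ?mul0r //; apply: contra T'b => Bbw.
  by rewrite -tiBw inE Bb mem_conjg wV.
rewrite -cfdot_Res_l cfdotE.
transitivity (#|B|%:R ^- 2 * \sum_(g in G) S g).
  rewrite exchange_big /= expr2 invfM -mulrA; congr (_ * _).
  rewrite mulr_sumr; apply: eq_bigr => b Bb.
  by rewrite cfResE // cfIndE // -mulrA mulr_suml.
rewrite (big_setID B) (setIidPr sBG) (eq_bigr _ S_B) (eq_bigr _ S_w) !sumr_const.
rewrite card_big_cell -[X in _ * (X + _)]mulr_natl -[X in _ * (_ + X)]mulr_natl cardB !natrM mulrDr.
have := neq0CG U; have := neq0CG T; move: (#|U|%:R) (#|T|%:R) '[_, _] (\sum_(t in T) _).
move=> x y c s y0 x0; have xy0 : x * y != 0 by rewrite mulf_neq0.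
congr (_ + _); first by rewrite (mulrA (x * y)) -expr2 mulKf ?expf_neq0.
have -> : x * y * x * s = (x * y) ^+ 2 * (y^-1 * s) by rewrite expr2 -!mulrA mulVKf.
by rewrite mulKf ?expf_neq0.
Qed.

End SplitRankOne.

(** * The irreducible characters of groups of Suzuki type *)

Lemma sum2_pow4 m x y : (4 ^ x + 4 ^ y = 2 * 4 ^ m -> x = m /\ y = m)%N.
Proof.
have P n : (0 < 4 ^ n)%N by rewrite expn_gt0.
elim: m x y => [|m IHm] [|x] [|y]; rewrite ?expnS ?expn0 // => h.
- by have := P y; lia.
- by have := P x; lia.
- by have := P x; have := P y; lia.
- by have := P m; lia.
- by have := P m; have := P y; lia.
- by have := P m; have := P x; lia.
by have [] := IHm x y; [lia | move=> -> ->].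
Qed.

(** The right side is odd, so one exponent is 0, and the other two follow by uniqueness in base 4.
    This is the equation for the degrees of the three nonlinear characters of B. *)
Lemma sum3_pow4 m x y z : (0 < m)%N -> (4 ^ x + 4 ^ y + 4 ^ z = 2 * 4 ^ m + 1)%N ->
  [\/ [/\ x = 0, y = m & z = m], [/\ x = m, y = 0 & z = m] |
      [/\ x = m, y = m & z = 0]]%N.
Proof.
case: m => // m _; case: x => [|x] h.
  by have [] := @sum2_pow4 m.+1 y z; [move: h; rewrite expn0; lia | constructor 1].
case: y h => [|y] h.
  by have [] := @sum2_pow4 m.+1 x.+1 z; [move: h; rewrite expn0; lia | constructor 2].
case: z h => [|z] h.
  by have [] := @sum2_pow4 m.+1 x.+1 y.+1; [move: h; rewrite expn0; lia | constructor 3].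
by move: h; rewrite !expnS; lia.
Qed.

(** All that the character theory needs to know about Sz(q). [suz_classesB] leaves three irreducible
    characters of B that are nontrivial on U, and [suz_sqr] makes the linear characters of U real,
    as the Gelfand-Graev argument requires. *)
Record suzuki_like m (gT : finGroupType) (G B U T : {group gT}) (w : gT) : Prop :=
  SuzukiLike {
    suz_rk1 : split_rank_one G B U T w;
    suz_exp : (0 < m)%N;
    suz_cardU : #|U| = ((2 ^ (2 * m).+1) ^ 2)%N;
    suz_cardT : #|T| = (2 ^ (2 * m).+1 - 1)%N;
    suz_abelT : abelian T;
    suz_classesB : #|classes B| = (2 ^ (2 * m).+1 + 2)%N;
    suz_sqr : {in U, forall u, u * u \in U^`(1)}%g
  }.

(** * Irreducible characters of the Borel subgroup *)

Section BorelCharacters.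

Variables (m : nat) (gT : finGroupType) (G B U T : {group gT}) (w : gT).
Hypothesis suzG : suzuki_like m G B U T w.
Let q := (2 ^ (2 * m).+1)%N.

Let rk1 := suz_rk1 suzG.
Let frobB := rk1_Frobenius rk1.
Let defB : U ><| T = B. Proof. by case/Frobenius_context: frobB. Qed.
Let sUB : U \subset B. Proof. by case/sdprodW/mulG_sub: defB. Qed.
Let nsUB : U <| B. Proof. by case/sdprod_context: defB. Qed.
Let cardB : (#|B| = #|U| * #|T|)%N. Proof. by rewrite (sdprod_card defB). Qed.
Let m_gt0 := suz_exp suzG.

Let q_ge8 : (8 <= q)%N.
Proof. by rewrite /q -[8%N]/(2 ^ 3)%N leq_exp2l //; lia. Qed.

Lemma lin_charT t : 'chi[T]_t \is a linear_char.
Proof. by have /char_abelianP := suz_abelT suzG; apply. Qed.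

Lemma card_IirrT : #|Iirr T| = (q - 1)%N.
Proof. by rewrite card_Iirr_abelian ?(suz_cardT suzG) ?(suz_abelT suzG). Qed.

Definition nonlin_Iirr := [set j : Iirr B | ~~ (U \subset cfker 'chi_j)].

Lemma nonlinPn (D : U ><| T = B) j :
  reflect (exists t, j = sdprod_Iirr D t) (j \notin nonlin_Iirr).
Proof.
rewrite inE negbK; apply: (iffP idP) => [kerU | [t ->]].
  by exists (Res_Iirr T j); rewrite sdprod_Res_IirrK.
by rewrite sdprod_IirrE cfker_sdprod.
Qed.

Lemma card_nonlin : #|nonlin_Iirr| = 3.
Proof.
have cardI : #|Iirr B| = (q + 2)%N by rewrite card_ord NirrE (suz_classesB suzG).
have := cardsC nonlin_Iirr; rewrite cardI.
have -> : ~: nonlin_Iirr = [set sdprod_Iirr defB t | t : Iirr T].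
  apply/setP=> j; rewrite inE; apply/(nonlinPn defB)/imsetP => -[t]; first by exists t.
  by move=> _ ->; exists t.
rewrite card_imset; last exact: sdprod_Iirr_inj.
by rewrite card_IirrT; lia.
Qed.

Lemma nonlin_Ind j : j \in nonlin_Iirr ->
  exists2 s : Iirr U, s != 0 & 'chi_j = 'Ind[B] 'chi_s.
Proof.
have frobBU : [Frobenius B with kernel U] by apply/existsP; exists T.
by rewrite inE => /(Frobenius_Ind_irrP frobBU).
Qed.

Lemma nonlin_off j b : j \in nonlin_Iirr -> b \notin U -> 'chi_j b = 0.
Proof.
case/nonlin_Ind=> s _ -> U'b; exact: (cfun_on0 (cfInd_normal _ nsUB)).
Qed.

(** The factor q - 1 is the index of U, and 2^e is the degree of the character of the 2-group U from
    which ['chi_j] is induced. *)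
Lemma nonlin_degree j : j \in nonlin_Iirr ->
  exists e, 'chi_j 1%g = ((q - 1) * 2 ^ e)%N%:R.
Proof.
case/nonlin_Ind=> s _ ->; rewrite cfInd1 // -divgS // cardB mulKn // (suz_cardT suzG).
have := dvd_irr1_cardG s; rewrite (suz_cardU suzG) irr1_degree dvdC_nat -expnM.
by case/(dvdn_pfactor _ _ (isT : prime 2)) => e _ ->; exists e; rewrite natrM.
Qed.

Lemma sum_nonlin : \sum_(j in nonlin_Iirr) 'chi_j 1%g ^+ 2 = ((q + 1) * (q - 1) ^ 2)%N%:R.
Proof.
have := irr_sum_square B; rewrite (bigID (mem nonlin_Iirr)) /=.
set S := \sum_(j in _) _.
rewrite (eq_bigl (mem [set sdprod_Iirr defB t | t : Iirr T])) => [|j]; last first.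
  by apply/(nonlinPn defB)/imsetP => -[t]; [exists t | move=> _ ->; exists t].
rewrite big_imset /=; last by move=> t t' _ _; apply: sdprod_Iirr_inj.
rewrite (eq_bigr (fun=> 1)) => [|t _]; last first.
  by rewrite sdprod_IirrE cfSdprod1 lin_char1 ?expr1n ?lin_charT.
rewrite sumr_const card_IirrT cardB (suz_cardU suzG) (suz_cardT suzG) -/q.
move/(canRL (addrK _)) => ->; rewrite -natrB.
  by congr _%:R; nia.
by nia.
Qed.

(** Dividing the sum of the squared degrees by (q - 1)^2 leaves a sum of three powers of 4 equal to
    q + 1 = 2 4^m + 1, so the exponents are 0, m, m up to order. *)
Lemma borel_nonlin : exists ja j1 j2,
  [/\ nonlin_Iirr = [set ja; j1; j2], [&& ja != j1, ja != j2 & j1 != j2],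
      'chi_ja 1%g = (q - 1)%N%:R, 'chi_j1 1%g = ((q - 1) * 2 ^ m)%N%:R
    & 'chi_j2 1%g = ((q - 1) * 2 ^ m)%N%:R].
Proof.
have [x Nx] : exists x, x \in nonlin_Iirr by apply/card_gt0P; rewrite card_nonlin.
have /eqP/cards2P[y [z [neq_yz defN']]] : #|nonlin_Iirr :\ x| = 2.
  by move: (cardsD1 x nonlin_Iirr); rewrite Nx card_nonlin add1n => -[].
have : y \in nonlin_Iirr :\ x by rewrite defN' set21.
have : z \in nonlin_Iirr :\ x by rewrite defN' set22.
case/setD1P=> neq_zx Nz /setD1P[neq_yx Ny].
have defN : nonlin_Iirr = [set x; y; z].
  by rewrite -(setD1K Nx) defN' setUA.
have [ex dx] := nonlin_degree Nx.
have [ey dy] := nonlin_degree Ny.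
have [ez dz] := nonlin_degree Nz.
have := sum_nonlin.
rewrite (big_setD1 x) //= defN' big_setU1 ?inE //= big_set1 dx dy dz -!natrX -!natrD.
move/eqP; rewrite eqr_nat => /eqP; rewrite !expnMn -!mulnDr mulnC => /eqP.
rewrite eqn_pmul2r ?expn_gt0 ?subn_gt0; last by rewrite (leq_trans _ q_ge8).
have pow4 e : ((2 ^ e) ^ 2 = 4 ^ e)%N by rewrite -expnM mulnC expnM.
rewrite !pow4 => /eqP e4.
have [] := sum3_pow4 m_gt0 (_ : 4 ^ ex + 4 ^ ey + 4 ^ ez = 2 * 4 ^ m + 1)%N.
- by rewrite -addnA e4 /q expnS expnM.
- case=> Ex Ey Ez; exists x, y, z; rewrite dx dy dz Ex Ey Ez expn0 muln1.
  by split=> //; rewrite eq_sym neq_yx eq_sym neq_zx.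
- case=> Ex Ey Ez; exists y, x, z; rewrite dx dy dz Ex Ey Ez expn0 muln1.
  by split=> //; [rewrite defN (setUC [set x]) | rewrite neq_yx neq_yz eq_sym].
case=> Ex Ey Ez; exists z, x, y; rewrite dx dy dz Ex Ey Ez expn0 muln1; split=> //.
  by rewrite defN setUC setUA.
by rewrite neq_zx (eq_sym z) neq_yz eq_sym.
Qed.

End BorelCharacters.

(** * Multiplicities under restriction and induction *)

Section Multiplicity.

Variables (gT : finGroupType) (G B : {group gT}).

(** Truncated to a natural number, so that the Gram relations become identities in [nat]. *)
Definition Res_mult (j : Iirr B) (i : Iirr G) : nat :=
  Num.truncn '['Res[B] 'chi[G]_i, 'chi_j].

Lemma Res_multE j i : (Res_mult j i)%:R = '['Res[B] 'chi[G]_i, 'chi_j].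
Proof. by apply: truncnK; rewrite ?Cnat_cfdot_char ?cfRes_char ?irr_char. Qed.

Lemma Res_mult_gram j k :
  '['Ind[G] 'chi[B]_j, 'Ind[G] 'chi[B]_k] =
  (\sum_i Res_mult j i * Res_mult k i)%N%:R.
Proof.
have multE l i : '['Ind[G] 'chi[B]_l, 'chi_i] = (Res_mult l i)%:R.
  by rewrite -Frobenius_reciprocity cfdotC -Res_multE conjC_nat.
rewrite cfdot_sum_irr natr_sum; apply: eq_bigr => i _.
by rewrite natrM !multE conjC_nat.
Qed.

Lemma Res_mult_degree j :
  'Ind[G] 'chi[B]_j 1%g = \sum_i (Res_mult j i)%:R * 'chi[G]_i 1%g.
Proof.
rewrite {1}['Ind[G] _]cfun_sum_cfdot sum_cfunE; apply: eq_bigr => i _.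
by rewrite cfunE cfdotC -cfdot_Res_l -Res_multE conjC_nat.
Qed.

Lemma Res_irr1 i : B \subset G -> 'chi[G]_i 1%g = \sum_j (Res_mult j i)%:R * 'chi[B]_j 1%g.
Proof.
move=> sBG; rewrite -(cfResE _ sBG (group1 B)) {1}['Res _]cfun_sum_cfdot sum_cfunE.
by apply: eq_bigr => j _; rewrite cfunE Res_multE.
Qed.

End Multiplicity.

(** * Constituents of the characters induced from B *)

Section SuzukiCharacters.

Variables (m : nat) (gT : finGroupType) (G B U T : {group gT}) (w : gT).
Hypothesis suzG : suzuki_like m G B U T w.
Let q := (2 ^ (2 * m).+1)%N.
Let d := (2 ^ m)%N.

Let rk1 := suz_rk1 suzG.
Let frobB := rk1_Frobenius rk1.
Let sBG := rk1_sub rk1.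
Let defB : U ><| T = B. Proof. by case/Frobenius_context: frobB. Qed.
Let sUB : U \subset B. Proof. by case/sdprodW/mulG_sub: defB. Qed.
Let tiUT : U :&: T = 1%g. Proof. by case/sdprodP: defB. Qed.
Let m_gt0 := suz_exp suzG.

Let def_q : q = (2 * d ^ 2)%N.
Proof. by rewrite /q /d expnS -expnM (mulnC m). Qed.
Let d_ge2 : (2 <= d)%N.
Proof. by rewrite /d -[X in (X <= _)%N]expn1 leq_exp2l. Qed.
Let q_ge8 : (8 <= q)%N. Proof. by rewrite def_q; move: d_ge2; clear; nia. Qed.
Let cardG : #|G| = (q ^ 2 * (q ^ 2 + 1) * (q - 1))%N.
Proof.
rewrite (card_rank1 rk1) -(sdprod_card defB) (suz_cardU suzG) (suz_cardT suzG) -/q.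
by rewrite addn1; ring.
Qed.
Let indexB : #|G : B| = (q ^ 2 + 1)%N.
Proof. by rewrite (index_rank1 rk1) (suz_cardU suzG) addn1. Qed.

Notation N := (nonlin_Iirr B U).
Notation lin t := (sdprod_Iirr defB t).
Notation mm := (@Res_mult _ G B).

Let nonlin_T j t : j \in N -> t \in T -> t != 1%g -> 'chi_j t = 0.
Proof.
move=> Nj Tt nt_t; apply: (nonlin_off suzG) => //; apply: contra nt_t => Ut.
by rewrite -in_set1 -set1gE -tiUT inE Ut.
Qed.

Let sum_nonlin_T j (f : gT -> algC) : j \in N ->
  \sum_(t in T) f t * ('chi_j t)^* = f 1%g * 'chi_j 1%g.
Proof.
move=> Nj; rewrite (big_setD1 1%g) //= big1 ?addr0 => [|t /setD1P[nt_t Tt]].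
  by rewrite conj_natr ?Cnat_irr1.
by rewrite nonlin_T // conjC0 mulr0.
Qed.

(** Both characters vanish outside U, so only t = 1 survives in the sum over T of Mackey's formula;
    it contributes the product of the degrees divided by |T| = q - 1. *)
Lemma gram_nonlin j k dj dk : j \in N -> k \in N ->
  'chi_j 1%g = ((q - 1) * dj)%N%:R -> 'chi_k 1%g = ((q - 1) * dk)%N%:R ->
  (\sum_i mm j i * mm k i = (j == k) + (q - 1) * (dj * dk))%N.
Proof.
move=> Nj Nk Dj Dk; apply/eqP; rewrite -(eqr_nat algC) -Res_mult_gram.
rewrite (mackey_rank1 rk1) sum_nonlin_T // invg1 Dj Dk cfdot_irr (suz_cardT suzG) -/q.
have q1 : (q - 1)%:R != 0 :> algC by rewrite pnatr_eq0; move: q_ge8; clear; lia.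
by rewrite natrD !natrM -(mulrA _ dj%:R) mulKf // mulrCA.
Qed.

Let lin1 t : 'chi_(lin t) 1%g = 1.
Proof. by rewrite sdprod_IirrE cfSdprod1 lin_char1 ?(lin_charT suzG). Qed.

Lemma gram_lin_nonlin t k dk : k \in N -> 'chi_k 1%g = ((q - 1) * dk)%N%:R ->
  (\sum_i mm (lin t) i * mm k i = dk)%N.
Proof.
move=> Nk Dk; apply/eqP; rewrite -(eqr_nat algC) -Res_mult_gram.
rewrite (mackey_rank1 rk1) sum_nonlin_T // invg1 Dk lin1 cfdot_irr (suz_cardT suzG) -/q.
have /negPf-> : lin t != k.
  by apply: contraTneq Nk => <-; apply/(nonlinPn defB); exists t.
by rewrite add0r mul1r natrM mulKf // pnatr_eq0; move: q_ge8; clear; lia.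
Qed.

Lemma gram_lin t t' :
  (\sum_i mm (lin t) i * mm (lin t') i = (t == t') + (conjC_Iirr t == t'))%N.
Proof.
apply/eqP; rewrite -(eqr_nat algC) -Res_mult_gram (mackey_rank1 rk1).
rewrite cfdot_irr (inj_eq (sdprod_Iirr_inj defB)) natrD; apply/eqP; congr (_ + _).
rewrite -cfdot_irr cfdotE; congr (_ * _); apply: eq_bigr => x Tx.
rewrite !sdprod_IirrE !cfSdprodEr ?groupV // conjC_IirrE cfunE.
by rewrite (lin_charV_conj (lin_charT suzG t)).
Qed.

Let X t := cfIirr ('Ind[G] 'chi_(lin t)).
Let X0 := [set t : Iirr T | t != 0].

(** A self-conjugate linear character has values of square 1, and the order of T is odd. *)
Let conjC_neq (t : Iirr T) : t != 0 -> conjC_Iirr t != t.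
Proof.
apply: contra => /eqP eq_t; rewrite -irr_eq1; apply/eqP/cfun_inP=> x Tx.
have lin_t := lin_charT suzG t; rewrite cfun1E Tx.
have sq1 : 'chi_t x ^+ 2 = 1.
  have eV : 'chi_t x^-1%g = 'chi_t x.
    by rewrite (lin_charV_conj lin_t) // -[in RHS]eq_t conjC_IirrE cfunE.
  by rewrite expr2 -{2}eV -(lin_charM lin_t) ?groupV // mulgV lin_char1.
have : 'chi_t x ^+ #|T| = 1 by rewrite -(lin_charX lin_t) // expg_cardG // lin_char1.
rewrite -(odd_double_half #|T|) (suz_cardT suzG) oddB ?expn_gt0 // oddX /=.
by rewrite -muln2 mulnC exprD exprM sq1 expr1n mulr1.
Qed.

Let XE (t : Iirr T) : t != 0 -> 'chi_(X t) = 'Ind[G] 'chi_(lin t).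
Proof.
move=> nz_t; rewrite cfIirrE // irrEchar cfInd_char ?irr_char // Res_mult_gram gram_lin.
by rewrite eqxx (negPf (conjC_neq nz_t)) /= eqxx.
Qed.

Let mult_X (t : Iirr T) i : t != 0 -> mm (lin t) i = (X t == i).
Proof.
move=> nz_t; apply/eqP; rewrite -(eqr_nat algC) Res_multE cfdot_Res_l -XE //.
by rewrite cfdot_irr (eq_sym i).
Qed.

Let mult0 k : mm k 0 = (k == 0).
Proof.
apply/eqP; rewrite -(eqr_nat algC) Res_multE irr0 cfRes_cfun1 // -irr0 cfdot_irr.
by rewrite (eq_sym 0).
Qed.

(** The character induced from the trivial character of B has norm 2 and contains the trivial
    character of G once; the other constituent [st] is the Steinberg character. *)
Let st_exists : exists2 st, st != 0 &
  forall i, mm (lin 0) i = ((i == 0%R) + (i == st))%N.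
Proof.
have := gram_lin (0 : Iirr T) (0 : Iirr T); rewrite conjC_Iirr0 eqxx (bigD1 0) //= mult0 sdprod_Iirr0 eqxx.
move=> sum2; have {sum2} : (\sum_(i : Iirr G | i != 0%R) mm 0%R i * mm 0%R i = 1)%N.
  by move: sum2; rewrite mul1n add1n => -[].
case: (pickP (fun i : Iirr G => (i != 0) && (mm 0 i != 0%N))) => [st /andP[nz_st mst] sum1 | no_st].
  exists st => // i; move: sum1; rewrite (bigD1 st) //=.
  set S := (\sum_(_ | _) _)%N => e.
  have [mst1 S0] : mm 0 st = 1%N /\ S = 0%N.
    by move: e mst; move: (mm 0 st) S => x y; clear; nia.
  have [->|nz_i] := eqVneq i 0; first by rewrite mult0 eqxx eq_sym (negPf nz_st).
  have [->//|neq_i] := eqVneq i st.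
  have /eqP := S0; rewrite sum_nat_eq0 => /forallP/(_ i).
  by rewrite nz_i neq_i muln_eq0 orbb => /eqP.
rewrite big1 // => i nz_i; have := no_st i.
by rewrite nz_i /= => /negbFE/eqP->.
Qed.

Lemma suzuki_irr : exists2 XS : {set Iirr G},
  [/\ #|Iirr G| = (q + 3)%N, #|XS| = (q %/ 2 - 1)%N &
      forall i, i \in XS -> 'chi_i 1%g = (q ^ 2 + 1)%N%:R /\
        exists (D : U ><| T = B) t, 'chi_i = 'Ind[G] (cfSdprod D 'chi_t)] &
  forall i, i \notin XS -> i != 0 -> exists2 n, 'chi_i 1%g = n%:R &
    n = (q ^ 2)%N \/ [\/ n = (q - 1) * d, n = (q - 1) * (q + 1 - 2 * d) |
       n = (q - 1) * (q + 1 + 2 * d)]%N.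
Proof.
have [st nz_st m0E] := st_exists.
pose XS := X @: X0.
have X_not0st t : t != 0 -> X t != 0 /\ X t != st.
  move=> nz_t; have /eqP := gram_lin (0 : Iirr T) t.
  rewrite conjC_Iirr0 !(eq_sym 0 t) (negPf nz_t) sum_nat_eq0 => /forallP/(_ (X t)) /=.
  rewrite (mult_X _ nz_t) eqxx muln1 m0E.
  by case: (X t == 0) (X t == st) => [] [].
have eqX t t' : t != 0 -> t' != 0 -> (X t == X t') = (t == t') || (conjC_Iirr t == t').
  move=> nz_t nz_t'; have := gram_lin t t'.
  under eq_bigr => i _ do rewrite !mult_X //.
  rewrite (bigD1 (X t)) //= eqxx mul1n big1 ?addn0 => [|i neq_i].
    rewrite [X t' == _]eq_sym => e; move: e.
    by case: (X t == X t'); case: (t == t'); case: (conjC_Iirr t == t').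
  by rewrite eq_sym (negPf neq_i).
have cardXS : #|XS| = (q %/ 2 - 1)%N.
  have cX0 : #|X0| = (q - 2)%N.
    have := cardsC1 (0 : Iirr T); rewrite (card_IirrT suzG) -/q => e.
    transitivity #|[set~ (0 : Iirr T)]|; last by rewrite e; clear; lia.
    by apply: eq_card => t; rewrite !inE.
  (* The fibres of [X] are the pairs of a nontrivial character of T and its conjugate. *)
  have : #|X0| = (2 * #|XS|)%N.
    rewrite -sum1_card (partition_big_imset X) /= [RHS]mulnC -[RHS]sum_nat_const.
    apply: eq_bigr => x /imsetP[t]; rewrite inE => nz_t -> {x}.
    transitivity #|[set t; conjC_Iirr t]|; last first.
      by rewrite cards2 eq_sym conjC_neq.
    rewrite -sum1_card; apply: eq_bigl => t'; rewrite !inE.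
    have [->|nz_t'] := eqVneq t' 0.
      by rewrite !(eq_sym 0) conjC_Iirr_eq0 (negPf nz_t).
    by rewrite /= [RHS]orbC eq_sym eqX // !(eq_sym t') orbC.
  by rewrite cX0 def_q; clear; lia.
(* The cuspidal characters: none of their constituents on B is trivial on U. *)
pose C : {set Iirr G} := ~: (0 |: (st |: XS)).
have sumE (f : Iirr G -> nat) :
    (\sum_i f i = f 0%R + (f st + (\sum_(i in XS) f i + \sum_(i in C) f i)))%N.
  rewrite (bigD1 0) //= (bigD1 st) //= (bigID (mem XS)) /=.
  do 3!congr (_ + _)%N; apply: eq_bigl => i; last by rewrite !inE !negb_or andbA.
  case XSi: (i \in XS); rewrite ?andbF ?andbT //.
  by have /imsetP[t] := XSi; rewrite inE => /X_not0st[nX0 nXst] ->; rewrite nX0.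
have C_lin t i : i \in C -> mm (lin t) i = 0%N.
  rewrite !inE !negb_or => /and3P[nz_i neq_i XS'i].
  have [->|nz_t] := eqVneq t 0.
    by rewrite m0E (negPf nz_i) (negPf neq_i).
  rewrite mult_X //; case: eqP => // def_i.
  by case/negP: XS'i; rewrite -def_i imset_f ?inE.
have [ja [j1 [j2 [defN /and3P[na1 na2 n12] da d1 d2]]]] := borel_nonlin suzG.
have mult_noncusp k dk : k \in N -> 'chi_k 1%g = ((q - 1) * dk)%N%:R ->
    [/\ mm k 0 = 0%N, mm k st = dk & forall i, i \in XS -> mm k i = dk].
  move=> Nk Dk.
  have mk0 : mm k 0 = 0%N.
    rewrite mult0; case: eqP Nk => // ->.
    by rewrite inE irr0 cfker_cfun1 sUB.
  split=> // [|x /imsetP[t]].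
    have := gram_lin_nonlin (0 : Iirr T) Nk Dk; rewrite (bigD1 0) //= mk0.
    rewrite muln0 (bigD1 st) //= m0E (negPf nz_st) eqxx mul1n big1 ?addn0 // => i.
    by case/andP=> nz_i neq_i; rewrite m0E (negPf nz_i) (negPf neq_i).
  rewrite inE => nz_t -> {x}; have := gram_lin_nonlin t Nk Dk.
  rewrite (bigD1 (X t)) //= mult_X // eqxx mul1n big1 ?addn0 // => i neq_i.
  by rewrite mult_X // eq_sym (negPf neq_i).
have cXS : #|XS| = (d ^ 2 - 1)%N by rewrite cardXS def_q mulKn.
(* The Steinberg character and the d^2 - 1 members of [XS] each contribute [dj * dk], which lowers
   the coefficient q - 1 = 2d^2 - 1 to d^2 - 1. *)
have gramC j k dj dk : j \in N -> k \in N ->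
    'chi_j 1%g = ((q - 1) * dj)%N%:R -> 'chi_k 1%g = ((q - 1) * dk)%N%:R ->
  (\sum_(i in C) mm j i * mm k i = (j == k) + (d ^ 2 - 1) * (dj * dk))%N.
  move=> Nj Nk Dj Dk; have := gram_nonlin Nj Nk Dj Dk.
  have [j0 jst jX] := mult_noncusp _ _ Nj Dj; have [k0 kst kX] := mult_noncusp _ _ Nk Dk.
  rewrite sumE j0 jst kst mul0n add0n.
  rewrite (eq_bigr (fun=> dj * dk)%N) => [|i XSi]; last by rewrite jX ?kX.
  rewrite sum_nat_const cXS def_q.
  move: (\sum_(i in C) _)%N (dj * dk)%N (j == k) => S P e.
  have : (0 < d ^ 2)%N by rewrite expn_gt0; move: d_ge2; case: (d).
  case: (d ^ 2)%N => [//|f _]; have -> : (2 * f.+1 - 1 = 2 * f + 1)%N by clear; lia.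
  rewrite subn1 /= mulnDl -mulnA mul1n; move: (f * P)%N (nat_of_bool e) => x y.
  by clear; lia.
have degC i : i \in C ->
    'chi_i 1%g = ((q - 1) * (mm ja i + d * (mm j1 i + mm j2 i)))%N%:R.
  move=> Ci; rewrite (Res_irr1 _ sBG) (bigID (mem N)) /= [X in _ + X]big1 ?addr0 => [|j].
    rewrite (eq_bigl (mem [set ja; j1; j2])) => [|j]; last by rewrite -defN.
    rewrite -setUA !big_setU1 ?inE ?negb_or ?na1 //= big_set1 da d1 d2 -!natrM -!natrD.
    by congr _%:R; ring.
  by case/(nonlinPn defB)=> t ->; rewrite C_lin // mul0r.
have [Nja Nj1 Nj2] : [/\ ja \in N, j1 \in N & j2 \in N].
  by rewrite defN !inE !eqxx !orbT.
(* Degree q - 1 = |T| means that [ja] is induced from a linear character [s] of U. Squares of U lie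
   in the derived subgroup, so [s] is real, and by reciprocity the multiplicity of [ja] is that of
   [s]. *)
have a_le1 : {in C, forall i, mm ja i <= 1}%N.
  move=> i _; have [s nz_s def_ja] := nonlin_Ind suzG Nja.
  have q1 : (q - 1)%:R != 0 :> algC by rewrite pnatr_eq0; move: q_ge8; clear; lia.
  have lin_s : 'chi_s \is a linear_char.
    rewrite qualifE/= irr_char /=; have := da; rewrite def_ja cfInd1 //.
    rewrite -divgS // -(sdprod_card defB) mulKn // (suz_cardT suzG).
    by rewrite -[X in _ = X -> _]mulr1 => /(mulfI q1)->.
  rewrite -(ler_nat algC) Res_multE def_ja -cfdot_Res_l cfResRes //.
  apply: (gelfand_graev rk1 i nz_s lin_s) => u Uu; have nz_u := lin_char_neq0 lin_s Uu.
  rewrite (lin_charV lin_s) // -[RHS](mulfK nz_u) -(lin_charM lin_s) //.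
  have ker_uu : (u * u)%g \in cfker 'chi_s.
    by rewrite (subsetP (lin_char_der1 lin_s)) ?(suz_sqr suzG).
  by rewrite (cfker1 ker_uu) lin_char1 ?mul1r.
have Da : 'chi_ja 1%g = ((q - 1) * 1)%N%:R by rewrite muln1.
have [cardC degC'] : #|C| = (d ^ 2 + 2)%N /\
    {in C, forall i, [\/ mm ja i + d * (mm j1 i + mm j2 i) = d,
       mm ja i + d * (mm j1 i + mm j2 i) + 2 * d = 2 * d ^ 2 + 1 |
       mm ja i + d * (mm j1 i + mm j2 i) = 2 * d ^ 2 + 1 + 2 * d]%N}.
  have d2_gt0 : (0 < d ^ 2)%N by rewrite expn_gt0; move: d_ge2; case: (d).
  apply: gram_solution => //.
  - by rewrite /d oddX /= orbF -lt0n.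
  - by rewrite (gramC _ _ _ _ Nja Nja Da Da) eqxx !muln1 subnKC.
  - by rewrite (gramC _ _ _ _ Nja Nj1 Da d1) (negPf na1) mul1n mulnC.
  - by rewrite (gramC _ _ _ _ Nja Nj2 Da d2) (negPf na2) mul1n mulnC.
  - by rewrite (gramC _ _ _ _ Nj1 Nj1 d1 d1) eqxx mulnn.
  - by rewrite (gramC _ _ _ _ Nj2 Nj2 d2 d2) eqxx mulnn.
  - by rewrite (gramC _ _ _ _ Nj1 Nj2 d1 d2) (negPf n12) mulnn.
  - move=> i /degC; case: posnP => // ->.
    by rewrite muln0 => /eqP; rewrite (negPf (irr1_neq0 i)).
  move=> i /degC Di; have := dvd_irr1_cardG i; rewrite Di dvdC_nat cardG def_q mulnC.
  by rewrite dvdn_pmul2r // subn_gt0 -def_q (leq_trans _ q_ge8).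
exists XS.
  split=> //.
    (* The count is 1 + 1 + (d^2 - 1) + (d^2 + 2) = q + 3. *)
    by rewrite -sum1_card sumE !sum1_card cXS cardC def_q; move: d_ge2; clear; nia.
  move=> i /imsetP[t]; rewrite inE => nz_t -> {i}; split.
    by rewrite XE // cfInd1 // lin1 indexB mulr1.
  by exists defB, t; rewrite XE // sdprod_IirrE.
move=> i XS'i nz_i.
have [Ci | C'i] := boolP (i \in C).
  exists ((q - 1) * (mm ja i + d * (mm j1 i + mm j2 i)))%N; first exact: degC.
  right; rewrite def_q; case: (degC' i Ci) => [->|e|->]; [constructor 1 | constructor 2 | constructor 3] => //.
  by rewrite -e addnK.
have {C'i} -> : i = st.
  by move: C'i; rewrite !inE (negPf nz_i) (negPf XS'i) orbF negbK => /eqP.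
exists (q ^ 2)%N; last by left.
have := Res_mult_degree G (lin 0); rewrite cfInd1 // lin1 indexB mulr1.
rewrite (bigD1 0) //= (bigD1 st) //= big1 ?addr0 => [|j /andP[nz_j neq_j]]; last first.
  by rewrite m0E (negPf nz_j) (negPf neq_j) mul0r.
rewrite !m0E !eqxx (negPf nz_st) eq_sym (negPf nz_st) irr0 cfun11 !mul1r natrD.
by move=> e; apply: (addrI 1); rewrite -e addrC.
Qed.

End SuzukiCharacters.

(** * Permutation characters and imprimitivity *)

Section IndexArithmetic.

Local Open Scope nat_scope.

Variables (d n : nat).
Let q := 2 * d ^ 2.
Hypothesis d_ge2 : 2 <= d.

(* The degrees of characters without trivial constituent, see suzuki_irr. *)
Inductive degree_sum : nat -> Prop :=
  DegreeSum a b c e z : degree_sum ((q - 1) * (a * d + b * (q + 1 - 2 * d)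
    + z * (q + 1 + 2 * d)) + c * q ^ 2 + e * (q ^ 2 + 1)).

Lemma degree_sum_mul k f :
    f = q ^ 2 \/ f = q ^ 2 + 1 \/ [\/ f = (q - 1) * d, f = (q - 1) * (q + 1 - 2 * d) |
       f = (q - 1) * (q + 1 + 2 * d)] ->
  degree_sum (k * f).
Proof.
have E a b c e z x : x = (q - 1) * (a * d + b * (q + 1 - 2 * d)
    + z * (q + 1 + 2 * d)) + c * q ^ 2 + e * (q ^ 2 + 1) -> degree_sum x.
  by move=> ->; constructor.
case=> [|[|[]]] ->.
- by apply: (@E 0 0 k 0 0); ring.
- by apply: (@E 0 0 0 k 0); ring.
- by apply: (@E k 0 0 0 0); ring.
- by apply: (@E 0 k 0 0 0); ring.
by apply: (@E 0 0 0 0 k); ring.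
Qed.

Lemma degree_sumD x y : degree_sum x -> degree_sum y -> degree_sum (x + y).
Proof.
have E a b c e z t : t = (q - 1) * (a * d + b * (q + 1 - 2 * d)
    + z * (q + 1 + 2 * d)) + c * q ^ 2 + e * (q ^ 2 + 1) -> degree_sum t.
  by move=> ->; constructor.
case=> a b c e z [a' b' c' e' z'].
by apply: (@E (a + a') (b + b') (c + c') (e + e') (z + z')); ring.
Qed.

Hypothesis n_gt0 : 0 < n.
Hypothesis sum_n : degree_sum n.

(** Substituting [d = e + 2] turns the truncated subtractions into polynomials with nonnegative
    coefficients. *)
Let param : exists e, [/\ d = e + 2, q = 2 * e ^ 2 + 8 * e + 8,
  q - 1 = 2 * e ^ 2 + 8 * e + 7, q + 1 - 2 * d = 2 * e ^ 2 + 6 * e + 5 &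
  q + 1 + 2 * d = 2 * e ^ 2 + 10 * e + 13].
Proof.
have [e de] : exists e, d = e + 2 by exists (d - 2); rewrite subnK.
by exists e; rewrite /q de -!mulnn; split=> //; clear; nia.
Qed.

(** Two summands among q^2 and q^2 + 1 would break the bound, so at most one occurs; all other
    degrees are multiples of q - 1. *)
Let degree_cases : n < 2 * q ^ 2 ->
  (exists2 a, n = (q - 1) * (a * d) & 0 < a) \/
  (exists2 s, n = (q - 1) * s & q + 1 - 2 * d <= s) \/
  (exists s, n = (q - 1) * s + q ^ 2) \/ (exists s, n = (q - 1) * s + q ^ 2 + 1).
Proof.
move: n_gt0; case: sum_n => a b c e z n0 lt_n.
have leyz : q + 1 - 2 * d <= q + 1 + 2 * d by clear; lia.
have ce : c + e < 2.
  rewrite ltnNge; apply/negP=> ce; have : 2 * q ^ 2 <= (c + e) * q ^ 2 by rewrite leq_mul2r ce orbT.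
  move: lt_n; move: ((q - 1) * _) (q ^ 2) => S Q; rewrite mulnDl mulnDr muln1.
  by move: (c * Q) (e * Q) => x1 x2; clear; lia.
set y := q + 1 - 2 * d in leyz n0 *; set z' := q + 1 + 2 * d in leyz n0 *.
case: c e ce n0 {lt_n} => [|[|[]]] // [|[|[]]] // _.
- rewrite !mul0n !addn0 => n0; case: (posnP b) => [b0 | b_gt0].
    case: (posnP z) => [z0 | z_gt0].
      left; exists a; first by rewrite b0 z0; ring.
      by move: n0; rewrite b0 z0; case: (a) => //; rewrite muln0.
    right; left; eexists; first by [].
    by move: z_gt0 leyz; case: (z) => // z1 _; rewrite mulSn; clear; lia.
  right; left; eexists; first by [].
  by move: b_gt0; case: (b) => // b1 _; rewrite mulSn; clear; lia.
- by move=> _; right; right; right; eexists; rewrite mul0n mul1n addn0 addnA.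
by move=> _; right; right; left; eexists; rewrite mul0n mul1n addn0.
Qed.

Let coprime_qS s r : coprime (q - 1) r -> coprime ((q - 1) * s + r) (q - 1).
Proof. by rewrite /coprime [gcdn _ (q - 1)]gcdnC mulnC gcdnMDl. Qed.

Let sizes : [/\ (q - 1) * d < q ^ 2, (q - 1) * (q + 1 - 2 * d) < q ^ 2,
  (q - 1) * (q + 1 + 2 * d) < 2 * q ^ 2, q ^ 2 < 2 * ((q - 1) * (q + 1 - 2 * d)) &
  [/\ d <= q + 1 - 2 * d, q + 1 - 2 * d <= (q - 1) * d & q + 1 + 2 * d <= (q - 1) * d]].
Proof.
have [e [-> -> -> -> ->]] := param.
by do 4![split=> //; try (rewrite -!mulnn; clear; nia)].
Qed.

Let gt_bound N : 0 < N -> N <= 2 * q ^ 2 -> n.+1 %| N -> n < N /\ n < 2 * q ^ 2.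
Proof. by move=> N0 leN /dvdn_leq => /(_ N0) lt_n; rewrite lt_n (leq_trans lt_n). Qed.

Let q1_gt0 : 0 < q - 1.
Proof. by have [e [_ _ -> _ _]] := param; rewrite addn_gt0 orbT. Qed.

(** The number (q - 1)d is the least nontrivial degree, so [n.+1] exceeds it. *)
Lemma index_ndvd_small : ~~ (n.+1 %| (q - 1) * d).
Proof.
have [s1 s2 s3 s4 [s5 s6 s7]] := sizes; apply/negP=> dvd_n.
have [ltn ltn2] : n < (q - 1) * d /\ n < 2 * q ^ 2.
  by apply: gt_bound => //; [rewrite muln_gt0 q1_gt0 (ltn_trans _ d_ge2) | move: s1; clear; lia].
have geP s : d <= s -> (q - 1) * d <= (q - 1) * s by move=> ?; rewrite leq_mul2l orbC; apply/orP; left.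
case: (degree_cases ltn2) => [[a def_n a_gt0]|[[s def_n le_s]|[[s def_n]|[s def_n]]]].
- by have := geP (a * d); rewrite leq_pmull // -def_n => /(_ isT); move: ltn; clear; lia.
- by have := geP s (leq_trans s5 le_s); rewrite -def_n; move: ltn; clear; lia.
- by move: s1 ltn; rewrite def_n; move: (q ^ 2) (_ * d) (_ * s) => x y z; clear; lia.
- by move: s1 ltn; rewrite def_n; move: (q ^ 2) (_ * d) (_ * s) => x y z; clear; lia.
Qed.

Let ndvd_coprime N s r : n.+1 = (q - 1) * s + r -> coprime (q - 1) r ->
  0 < N -> N < n.+1 -> n.+1 %| (q - 1) * N -> False.
Proof.
move=> def_n co N0 lt_n; rewrite Gauss_dvdr ?gtnNdvd //.
by rewrite def_n coprime_qS.
Qed.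

(** By size [n] can only be a multiple of (q - 1)d. Then [n.+1] is coprime to q - 1, so it would
    divide q + 1 - 2d, which is at most [n]. *)
Lemma index_ndvd_minus : ~~ (n.+1 %| (q - 1) * (q + 1 - 2 * d)).
Proof.
have [s1 s2 s3 s4 [s5 s6 s7]] := sizes; apply/negP=> dvd_n.
have y_gt0 : 0 < q + 1 - 2 * d by rewrite (leq_trans _ s5) // (ltn_trans _ d_ge2).
have [ltn ltn2] : n < (q - 1) * (q + 1 - 2 * d) /\ n < 2 * q ^ 2.
  by apply: gt_bound => //; [rewrite muln_gt0 q1_gt0 | move: s2; clear; lia].
case: (degree_cases ltn2) => [[a def_n a_gt0]|[[s def_n le_s]|[[s def_n]|[s def_n]]]].
- apply: (@ndvd_coprime (q + 1 - 2 * d) (a * d) 1) => //.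
  + by rewrite def_n addn1.
  + by rewrite coprimen1.
  by rewrite ltnS (leq_trans s6) // def_n leq_mul2l leq_pmull ?orbT.
- by move: ltn; rewrite def_n ltn_pmul2l // ltnNge le_s.
- by move: s2 ltn; rewrite def_n; move: (q ^ 2) (_ * (_ - _)) (_ * s) => x y z; clear; lia.
- by move: s2 ltn; rewrite def_n; move: (q ^ 2) (_ * (_ - _)) (_ * s) => x y z; clear; lia.
Qed.

(** Here a summand q^2 or q^2 + 1 cannot be excluded by size. Modulo q - 1, [n.+1] is 1, 2 or 3,
    hence coprime to q - 1, and it would divide q + 1 + 2d, which is smaller than [n.+1]. *)
Lemma index_ndvd_plus : coprime (q - 1) 3 -> ~~ (n.+1 %| (q - 1) * (q + 1 + 2 * d)).
Proof.
move=> co3; have [s1 s2 s3 s4 [s5 s6 s7]] := sizes; apply/negP=> dvd_n.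
have z_gt0 : 0 < q + 1 + 2 * d by rewrite addn1.
have [ltn ltn2] : n < (q - 1) * (q + 1 + 2 * d) /\ n < 2 * q ^ 2.
  by apply: gt_bound => //; [rewrite muln_gt0 q1_gt0 | move: s3; clear; lia].
have sq_q : q ^ 2 = (q - 1) * (q + 1) + 1.
  by have [e [_ -> -> _ _]] := param; rewrite -!mulnn; clear; lia.
have co2 : coprime (q - 1) 2 by rewrite coprimen2 oddB ?oddM // muln_gt0 expn_gt0 (ltn_trans _ d_ge2).
have z_small s : q ^ 2 <= s -> q + 1 + 2 * d < s.+1.
  by move=> le_s; move: s1 s7; clear -le_s; lia.
case: (degree_cases ltn2) => [[a def_n a_gt0]|[[s def_n le_s]|[[s def_n]|[s def_n]]]].
- apply: (@ndvd_coprime (q + 1 + 2 * d) (a * d) 1) => //; rewrite ?coprimen1 //; first by rewrite def_n addn1.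
  by rewrite ltnS (leq_trans s7) // def_n leq_mul2l leq_pmull ?orbT.
- apply: (@ndvd_coprime (q + 1 + 2 * d) s 1) => //; rewrite ?coprimen1 //; first by rewrite def_n addn1.
  by rewrite ltnS (leq_trans s7) // def_n leq_mul2l (leq_trans s5) ?orbT.
- apply: (@ndvd_coprime (q + 1 + 2 * d) (s + (q + 1)) 2) => //; first by rewrite def_n sq_q; ring.
  by apply: z_small; rewrite def_n leq_addl.
apply: (@ndvd_coprime (q + 1 + 2 * d) (s + (q + 1)) 3) => //; first by rewrite def_n sq_q; ring.
by apply: z_small; rewrite def_n -addnA (leq_trans (leq_addr 1 _)) ?leq_addl.
Qed.

(** A proper divisor of the 2-power q^2 is at most q^2 / 2 < (q - 1)(q + 1 - 2d), so [n] would be a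
    multiple of (q - 1)d. Then [n] is even and the power [n.+1] of 2 is odd, contradicting
    [n > 0]. *)
Lemma index_dvd_St k : q = 2 ^ k -> ~~ odd d -> n.+1 %| q ^ 2 -> n.+1 = q ^ 2.
Proof.
move=> q2 d_even dvd_n; have [s1 s2 s3 s4 _] := sizes.
have /(dvdn_pfactor _ _ (isT : prime 2))[l le_l def_n] : n.+1 %| 2 ^ (k * 2) by rewrite expnM -q2.
rewrite def_n q2 -expnM; congr (2 ^ _); apply/eqP; rewrite eqn_leq le_l leqNgt /=.
apply/negP=> lt_l; have le_n : 2 * n.+1 <= q ^ 2 by rewrite def_n q2 -expnM -expnS leq_exp2l.
have ltn2 : n < 2 * q ^ 2 by move: le_n; clear; lia.
case: (degree_cases ltn2) => [[a Dn a_gt0]|[[s Dn le_s]|[[s Dn]|[s Dn]]]].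
- have : odd n.+1 by rewrite /= Dn !oddM (negPf d_even) !andbF.
  rewrite def_n oddX orbF => /eqP l0; move: def_n n_gt0; rewrite l0 expn0 => -[->].
  by rewrite ltnn.
- have : (q - 1) * (q + 1 - 2 * d) <= n by rewrite Dn leq_mul2l le_s orbT.
  by move: s4 le_n; clear; lia.
- by move: le_n; rewrite Dn; move: (q ^ 2) ((q - 1) * s) => x y; clear; lia.
by move: le_n; rewrite Dn; move: (q ^ 2) ((q - 1) * s) => x y; clear; lia.
Qed.

End IndexArithmetic.

(** * Subgroups whose index divides a character degree *)

Section SuzukiImprimitive.

Local Open Scope nat_scope.

Variables (m : nat) (gT : finGroupType) (G B U T : {group gT}) (w : gT).
Hypothesis suzG : suzuki_like m G B U T w.
Let q := (2 ^ (2 * m).+1)%N.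
Let d := (2 ^ m)%N.

Let rk1 := suz_rk1 suzG.
Let frobB := rk1_Frobenius rk1.
Let sBG := rk1_sub rk1.
Let defB : U ><| T = B. Proof. by case/Frobenius_context: frobB. Qed.
Let sUB : U \subset B. Proof. by case/sdprodW/mulG_sub: defB. Qed.
Let sTB : T \subset B. Proof. by case/sdprodW/mulG_sub: defB. Qed.
Let m_gt0 := suz_exp suzG.
Let def_q : q = (2 * d ^ 2)%N.
Proof. by rewrite /q /d expnS -expnM (mulnC m). Qed.
Let d_ge2 : (2 <= d)%N.
Proof. by rewrite /d -[X in (X <= _)%N]expn1 leq_exp2l. Qed.
Let q_ge8 : (8 <= q)%N. Proof. by rewrite def_q; move: d_ge2; clear; nia. Qed.
Let cardG : #|G| = (q ^ 2 * (q ^ 2 + 1) * (q - 1))%N.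
Proof.
rewrite (card_rank1 rk1) -(sdprod_card defB) (suz_cardU suzG) (suz_cardT suzG) -/q.
by rewrite addn1; ring.
Qed.

Let odd_H : odd ((q - 1) * (q ^ 2 + 1)).
Proof. by rewrite oddM oddB ?expn_gt0 // oddD !oddX. Qed.

Let q1_gt0 : 0 < q - 1. Proof. by rewrite subn_gt0 (leq_trans _ q_ge8). Qed.

(** H has odd order and so meets the 2-group U trivially; hence H :&: B embeds into B / U, which
    bounds its order by q - 1. Since |HB| is at most |G|, both bounds are attained. *)
Let complU (H : {group gT}) : H \subset G -> #|H| = (q - 1) * (q ^ 2 + 1) ->
  #|H :&: B| = q - 1 /\ (H * B)%g = G.
Proof.
move=> sHG cardH.
have tiHU : H :&: U = 1%g.
  apply: coprime_TIg; rewrite cardH (suz_cardU suzG) !coprimeXr //.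
  by rewrite coprimen2 odd_H.
have leK : #|H :&: B| <= q - 1.
  have tiKU : (H :&: B) :&: U = 1%g by rewrite -setIA (setIidPr sUB).
  have : #|((H :&: B) * U)%g| <= #|B|.
    by apply: subset_leq_card; rewrite mul_subG ?subsetIr.
  rewrite (TI_cardMg tiKU) -(sdprod_card defB) mulnC leq_pmul2l ?cardG_gt0 //.
  by rewrite (suz_cardT suzG).
have sHBG : (H * B)%g \subset G by rewrite mul_subG.
have := mul_cardG H B; rewrite cardH -(sdprod_card defB) (suz_cardU suzG) (suz_cardT suzG) -/q.
have leHB := subset_leq_card sHBG; move: leHB; rewrite cardG => leHB e.
have q2_gt0 : 0 < q ^ 2 * (q ^ 2 + 1) * (q - 1).
  by rewrite !muln_gt0 q1_gt0 expn_gt0 addn1 ?andbT /=; move: q_ge8; case: (q).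
have e2 : q ^ 2 * (q ^ 2 + 1) * (q - 1) * (q - 1) = #|(H * B)%g| * #|H :&: B|.
  by rewrite -e; ring.
have cK : #|H :&: B| = q - 1.
  apply/eqP; rewrite eqn_leq leK /= -(leq_pmul2l q2_gt0) e2 leq_mul2r.
  by rewrite leHB orbT.
split=> //; apply/eqP; rewrite eqEcard sHBG cardG /=.
by move: e2; rewrite cK => /eqP; rewrite eqn_pmul2r // => /eqP->.
Qed.

(* Such an H would have odd order, but a conjugate of H would contain T, hence
   also the involution w, since the elements of B normalizing T lie in T. *)
Lemma no_complement_unip (H : {group gT}) : H \subset G -> #|G : H| <> (q ^ 2)%N.
Proof.
move=> sHG iH.
have cardH : #|H| = (q - 1) * (q ^ 2 + 1).
  have q2_gt0 : 0 < q ^ 2 by rewrite expn_gt0 expn_gt0.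
  apply/eqP; rewrite -(eqn_pmul2r q2_gt0) -iH Lagrange // cardG iH.
  by apply/eqP; ring.
have [cK _] := complU sHG cardH.
have [_ _ nUT _] := sdprodP defB.
have coUT : coprime #|U| #|T| by apply: Frobenius_coprime frobB.
have [x Ux defK] : exists2 x, x \in U & H :&: B = T :^ x.
  apply: (SchurZassenhaus_trans_sol _ nUT _ coUT).
  - apply: (@pgroup_sol _ 2); apply/pgroupP=> p pr_p.
    by rewrite (suz_cardU suzG) -expnM Euclid_dvdX // => /andP[]; rewrite dvdn_prime2.
  - by rewrite (sdprodW defB) subsetIr.
  by rewrite cK (suz_cardT suzG).
pose H1 := (H :^ x^-1)%G.
have sTH1 : T \subset H1 by rewrite -sub_conjg -defK subsetIl.
have Gx : x \in G by rewrite (subsetP (subset_trans sUB sBG)).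
have sH1G : H1 \subset G by rewrite -(conjGid (groupVr Gx)) conjSg.
have cardH1 : #|H1| = (q - 1) * (q ^ 2 + 1) by rewrite cardJg.
have [cK1 defG] := complU sH1G cardH1.
have defK1 : H1 :&: B = T.
  by apply/esym/eqP; rewrite eqEcard subsetI sTH1 sTB cK1 (suz_cardT suzG) /=.
have Tw : T :^ w = T.
  apply/eqP; rewrite eqEcard cardJg leqnn andbT.
  by apply/subsetP=> _ /imsetP[t Tt ->]; rewrite (rk1_inv rk1) ?groupV.
have [h [b [Hh Bb def_w]]] : exists h b, [/\ h \in H1, b \in B & w = h * b]%g.
  by have := rk1_mem rk1; rewrite -defG => /mulsgP[h b Hh Bb ->]; exists h, b.
(* As [w] normalizes [T], [T :^ b^-1] equals [T :^ h]. The first form lies in B and the second in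
   [H1], so both lie in H1 :&: B = T. *)
have nTb : b \in 'N(T).
  have TbV : T :^ b^-1 = T :^ h by rewrite -{1}Tw def_w conjsgM conjsgK.
  rewrite -groupV inE -{2}defK1 subsetI; apply/andP; split.
    by rewrite TbV; have := sTH1; rewrite -(conjSg _ _ h) (conjGid Hh).
  by have := sTB; rewrite -(conjSg _ _ b^-1) (conjGid (groupVr Bb)).
have Tb : b \in T.
  have /and3P[_ _ /and3P[_ _ /eqP defN]] := frobB.
  by rewrite -defN inE Bb normD1.
have Hw : w \in H1 by rewrite def_w groupM // (subsetP sTH1).
have ow : #[w] = 2.
  apply: nt_prime_order => //; first by rewrite expgS expg1 (rk1_invol rk1).
  by apply/eqP=> w1; have := notin_w rk1; rewrite w1 group1.
have := order_dvdG Hw; rewrite ow cardH1 dvdn2.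
by rewrite odd_H.
Qed.

Lemma suzuki_imprimitive (H : {group gT}) (i : Iirr G) n :
  H \proper G -> 'chi_i 1%g = n%:R%R -> #|G : H| %| n -> n = q ^ 2 + 1.
Proof.
case/andP=> sHG not_sGH Dn dvd_n.
have [XS [_ _ XSdeg] degs] := suzuki_irr suzG; rewrite -/q -/d in XSdeg degs.
have iH_gt1 : 1 < #|G : H| by rewrite indexg_gt1.
have [k Dk sum_k] : exists2 k, #|G : H| = k.+1 & degree_sum d k.
  have := Res_mult_degree G (0 : Iirr H)%R.
  rewrite irr0 cfInd1 // cfun11 mulr1 (bigD1 0%R) //=.
  have -> : Res_mult (0 : Iirr H)%R (0 : Iirr G)%R = 1.
    apply/eqP; rewrite -(eqr_nat algC) Res_multE irr0 cfRes_cfun1 // -irr0 cfdot_irr.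
    by rewrite eqxx.
  rewrite irr0 cfun11 mulr1.
  have [k -> sum_k] : exists2 k, (\sum_(j | j != 0) (Res_mult (0 : Iirr H) j)%:R * 'chi[G]_j 1%g = k%:R)%R & degree_sum d k.
    elim/big_ind: _ => [|x y [k1 -> sum1] [k2 -> sum2] | j nz_j].
    - exists (0 * (2 * d ^ 2) ^ 2); first by rewrite mul0n.
      by apply: degree_sum_mul; left.
    - by exists (k1 + k2); rewrite ?natrD //; apply: degree_sumD.
    have [f -> Df] : exists2 f, 'chi_j 1%g = f%:R%R & f = q ^ 2 \/ f = q ^ 2 + 1 \/
       [\/ f = (q - 1) * d, f = (q - 1) * (q + 1 - 2 * d) | f = (q - 1) * (q + 1 + 2 * d)].
      have [/XSdeg[-> _] | XS'j] := boolP (j \in XS); first by exists (q ^ 2 + 1); auto.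
      by have [f -> [|]] := degs j XS'j nz_j; exists f; auto.
    exists (Res_mult (0 : Iirr H)%R j * f); first by rewrite natrM.
    by rewrite def_q in Df; apply: degree_sum_mul.
  by move/eqP; rewrite -natrD eqr_nat add1n => /eqP ->; exists k.
rewrite Dk in iH_gt1 dvd_n.
have [/XSdeg[+ _] | XS'i] := boolP (i \in XS).
  by rewrite Dn => /eqP; rewrite eqr_nat => /eqP.
have [i0|nz_i] := eqVneq i 0%R.
  move: Dn; rewrite i0 irr0 cfun11 => /esym/eqP; rewrite pnatr_eq1 => /eqP n1.
  by move: dvd_n; rewrite n1 dvdn1 => /eqP; move: iH_gt1; case: (k).
have [f Df [] fE] := degs i XS'i nz_i.
  have {f Df fE} nE : n = q ^ 2.
    by apply/eqP; rewrite -(eqr_nat algC) -Dn Df fE.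
  case: (@no_complement_unip H) => //; rewrite Dk.
  rewrite def_q; apply: (index_dvd_St d_ge2 iH_gt1 sum_k (esym def_q)).
    by rewrite /d oddX /= orbF -lt0n.
  by rewrite -def_q -nE.
have nE : n = f by apply/eqP; rewrite -(eqr_nat algC) -Dn Df.
(* Multiplying by 4 preserves residues modulo 3, so the odd power q of 2 is 2 and q - 1 is 1 modulo
   3. *)
have co3 : coprime (2 * d ^ 2 - 1) 3.
  rewrite -def_q /q; elim: (m) => [|m' IHm]; first by [].
  have -> : 2 ^ (2 * m'.+1).+1 - 1 = 2 ^ (2 * m').+1 - 1 + 2 ^ (2 * m').+1 * 3.
    have -> : (2 * m'.+1).+1 = (2 * m').+1 + 2 by clear; lia.
    rewrite expnD.
    have : 0 < 2 ^ (2 * m').+1 by rewrite expn_gt0.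
    by move: (2 ^ _) => x; clear; lia.
  by rewrite coprime_sym /coprime addnC gcdnMDl -/(coprime _ _) coprime_sym.
move: dvd_n; rewrite nE; apply: contraTeq => _; rewrite def_q in fE.
case: fE => ->; [apply: index_ndvd_small|apply: index_ndvd_minus|apply: index_ndvd_plus] => //.
Qed.

End SuzukiImprimitive.

(** * Transfer of characters between fields *)

Section NumberFieldEmbedding.

Variables (F : fieldType) (charF : [pchar F] =i pred0).

Lemma intr_eq0_pchar0 (z : int) : (z%:~R == 0 :> F) = (z == 0).
Proof.
have nat_eq0 := proj1 (pcharf0P F) charF.
by case: z => n; rewrite ?NegzE ?mulrNz ?oppr_eq0 -pmulrn nat_eq0.
Qed.

(** [ratr] is computed from the reduced fraction; this allows any fraction with nonzero denominator,
    as sums and products produce them. *)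
Lemma ratr_frac (a b : int) (x : rat) :
  b != 0 -> x = a%:~R / b%:~R -> ratr x = a%:~R / b%:~R :> F.
Proof.
move=> nz_b def_x; rewrite /ratr; apply/eqP; rewrite eqr_div ?intr_eq0_pchar0 //.
rewrite -!intrM; apply/eqP; congr (_%:~R); apply: (@intr_inj rat).
by rewrite !intrM numqE {1}def_x mulrAC divfK ?intr_eq0.
Qed.

Lemma ratr_pchar0_zmod : zmod_morphism (@ratr F).
Proof.
move=> x y; have [nzx nzy] : (denq x)%:~R != 0 :> F /\ (denq y)%:~R != 0 :> F.
  by rewrite !intr_eq0_pchar0.
rewrite (@ratr_frac (numq x * denq y - numq y * denq x) (denq x * denq y)).
- by rewrite /ratr intrM intrB !intrM; field; rewrite nzx nzy.
- by rewrite mulf_neq0.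
by rewrite intrM intrB !intrM !numqE; field; rewrite !intr_eq0 !denq_eq0.
Qed.

Lemma ratr_pchar0_monoid : monoid_morphism (@ratr F).
Proof.
split=> [|x y]; first by rewrite /ratr divr1.
have [nzx nzy] : (denq x)%:~R != 0 :> F /\ (denq y)%:~R != 0 :> F.
  by rewrite !intr_eq0_pchar0.
rewrite (@ratr_frac (numq x * numq y) (denq x * denq y)).
- by rewrite /ratr !intrM; field; rewrite nzx nzy.
- by rewrite mulf_neq0.
by rewrite !intrM !numqE; field; rewrite !intr_eq0 !denq_eq0.
Qed.

End NumberFieldEmbedding.

(** Write L = Q(x) with a primitive element. The minimal polynomial of x has a root y in K, and p(x)
    |-> p(y) is well defined since that polynomial divides every p with p(x) = 0. *)
Lemma number_field_embedding (K : closedFieldType) (L : fieldExtType rat) :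
  [pchar K] =i pred0 -> inhabited {rmorphism L -> K}.
Proof.
move=> charK.
pose phiZ := GRing.isZmodMorphism.Build rat K (@ratr K) (ratr_pchar0_zmod charK).
pose phiM := GRing.isMonoidMorphism.Build rat K (@ratr K) (ratr_pchar0_monoid charK).
pose phi : {rmorphism rat -> K} := HB.pack (@ratr K : rat -> K) phiZ phiM.
have charL : [pchar L] =i pred0.
  by move=> p; rewrite pchar_lalg pchar_num.
have sepL : separable 1 {:L} by apply/separableP=> u _; apply: pcharf0_separable.
have := eq_adjoin_separable_generator sepL (sub1v _).
set x := separable_generator _ _ => defL.
pose ev (p : {poly rat}) := (map_poly (in_alg L) p).[x].
have ev_onto v : exists p, ev p == v.
  have : v \in <<1; x>>%VS by rewrite -defL memvf.
  by case/Fadjoin_polyP=> _ /polyOver1P[p ->] ->; exists p.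
have [r def_r] : exists r : {poly rat}, minPoly 1 x = map_poly (in_alg L) r.
  exact/polyOver1P/minPolyOver.
have [y ry0] : exists y, root (map_poly phi r) y.
  apply/closed_rootP; rewrite size_map_poly -(size_map_poly (in_alg L)) -def_r.
  by rewrite size_minPoly.
pose kap (p : {poly rat}) := (map_poly phi p).[y].
have kapB p1 p2 : kap (p1 - p2) = kap p1 - kap p2 by rewrite /kap rmorphB hornerD hornerN.
have kap0 p1 p2 : ev p1 = ev p2 -> kap p1 = kap p2.
  move/eqP; rewrite -subr_eq0 -hornerN -hornerD -rmorphB => ev0.
  have : minPoly 1 x %| map_poly (in_alg L) (p1 - p2).
    by apply: minPoly_dvdp ev0; apply/polyOver1P; exists (p1 - p2).
  rewrite def_r dvdp_map => dvd_r; apply/eqP; rewrite -subr_eq0 -kapB.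
  by apply: root_dvdp ry0; rewrite dvdp_map.
(* [xchoose] picks some p with p(x) = v; by [kap0] the choice does not matter. *)
pose f v := kap (xchoose (ev_onto v)).
have fE p : f (ev p) = kap p by apply: kap0; apply/eqP/(xchooseP (ev_onto _)).
have ev_cover v : exists p, v = ev p by have [p /eqP <-] := ev_onto v; exists p.
have fZ : zmod_morphism f.
  move=> u v; have [[p ->] [p' ->]] := (ev_cover u, ev_cover v).
  have -> : ev p - ev p' = ev (p - p') by rewrite /ev rmorphB hornerD hornerN.
  by rewrite !fE.
have fM : monoid_morphism f.
  split=> [|u v].
    have -> : 1 = ev 1 by rewrite /ev rmorph1 hornerE.
    by rewrite fE /kap rmorph1 hornerE.
  have [[p ->] [p' ->]] := (ev_cover u, ev_cover v).
  have -> : ev p * ev p' = ev (p * p') by rewrite /ev rmorphM hornerM.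
  by rewrite !fE /kap rmorphM hornerM.
pose fZm := GRing.isZmodMorphism.Build L K f fZ.
pose fMm := GRing.isMonoidMorphism.Build L K f fM.
by constructor; exact: (HB.pack f fZm fMm : {rmorphism L -> K}).
Qed.

Definition map_ffun (R S : Type) (gT : finGroupType) (f : R -> S) (phi : {ffun gT -> R}) :
  {ffun gT -> S} := [ffun x => f (phi x)].

Lemma char_of_map (L K : fieldType) (f : {rmorphism L -> K}) (gT : finGroupType)
    (G : {group gT}) n (rG : mx_representation L G n) :
  map_ffun f (char_of rG) = char_of (map_repr f rG).
Proof.
apply/ffunP=> x; rewrite !ffunE; case: ifP => _; last exact: rmorph0.
by rewrite trace_map_mx.
Qed.

(** The matrices ['Chi_i x], over all subgroups, characters and elements, have finitely many
    algebraic entries, which lie in one number field. Having the same L for G and T is what later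
    lets induction be compared across fields. *)
Lemma irr_realization (gT : finGroupType) :
  exists (L : fieldExtType rat) (iota : {rmorphism L -> algC}),
  forall (G : {group gT}) (i : Iirr G), exists n (rG : mx_representation L G n),
    mx_absolutely_irreducible rG /\ forall x, iota (char_of rG x) = 'chi_i x.
Proof.
pose entries (G : {group gT}) (i : Iirr G) (x : gT) :=
  codom (fun ab => 'Chi_i x ab.1 ab.2).
pose s := flatten (codom (fun G : {group gT} =>
  flatten (codom (fun i : Iirr G => flatten (codom (@entries G i)))))).
have s_entry (G : {group gT}) (i : Iirr G) x a b : 'Chi_i x a b \in s.
  apply/flattenP; eexists; first exact: codom_f G.
  apply/flattenP; eexists; first exact: codom_f i.
  apply/flattenP; eexists; first exact: codom_f x.
  exact: (codom_f (fun ab => 'Chi_i x ab.1 ab.2) (a, b)).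
have [L [iota [s1 def_s _]]] := num_field_exists s; exists L, iota => G i.
(* A preimage under [iota]; the default 0 is never reached on entries of the list [s]. *)
pose pre z := nth 0 s1 (index z s).
have preK z : z \in s -> iota (pre z) = z.
  move=> sz; have lt_z : (index z s < size s1)%N by rewrite -(size_map iota) def_s index_mem.
  by rewrite /pre -(nth_map 0 0 iota lt_z) def_s nth_index.
pose r x := map_mx pre ('Chi_i x).
have rK x : map_mx iota (r x) = 'Chi_i x.
  by apply/matrixP=> a b; rewrite 2!mxE preK ?s_entry.
have rP : mx_repr G r.
  split=> [|x y Gx Gy]; apply: (@map_mx_inj _ _ iota).
    by rewrite rK map_mx1 repr_mx1.
  by rewrite map_mxM !rK repr_mxM.
pose rG := MxRepresentation rP; exists _, rG.
have rsimG : mx_rsim (map_repr iota rG) 'Chi_i.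
  exists 1%:M; rewrite ?row_free_unit ?unitmx1 // => x Gx.
  by rewrite mulmx1 mul1mx; apply: rK.
split.
  rewrite -(map_mx_abs_irr iota).
  by apply: groupC; apply/(mx_rsim_irr (mx_rsim_sym rsimG))/socle_irr.
move=> x; rewrite ffunE; case: ifPn => [Gx | G'x]; last by rewrite rmorph0 cfun0.
by rewrite -irrRepr cfunE Gx /= -trace_map_mx rK.
Qed.

Lemma pchar0_pgroup (K : fieldType) (gT : finGroupType) (G : {group gT}) :
  [pchar K] =i pred0 -> [pchar K]^'.-group G.
Proof. by move=> charK; apply/pgroupP=> p _ _; rewrite inE /= charK. Qed.

(** Absolutely irreducible representations stay irreducible along [kappa]. They give all irreducible
    K-characters by counting: over both [algC] and K their number is the number of classes of G, so
    the injection [c] is a bijection. *)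
Lemma irr_char_transfer (K : closedFieldType) (gT : finGroupType) :
    [pchar K] =i pred0 ->
  exists (L : fieldType) (iota : {rmorphism L -> algC}) (kappa : {rmorphism L -> K}),
  forall G : {group gT}, exists f : Iirr G -> {ffun gT -> L},
  [/\ forall i x, iota (f i x) = 'chi_i x,
      forall i, 'chi_i \is a linear_char -> is_linear_char G (map_ffun kappa (f i)),
      injective (fun i => map_ffun kappa (f i))
    & forall chi, is_irr_char G chi <-> exists i, chi = map_ffun kappa (f i)].
Proof.
move=> charK; have [L [iota real_irr]] := irr_realization gT.
have [kappa] := number_field_embedding L charK.
exists L, iota, kappa => G.
have /fin_all_exists[f fP] : forall i : Iirr G, exists f : {ffun gT -> L},
    exists n (rG : mx_representation L G n),
    [/\ mx_absolutely_irreducible rG, f = char_of rG & forall x, iota (f x) = 'chi_i x].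
  by move=> i; have [n [rG [irrG chiE]]] := real_irr G i; exists (char_of rG), n, rG.
have iotaf i x : iota (f i x) = 'chi_i x by have [n [rG [_ _ ->]]] := fP i.
have inj_f : injective (fun i => map_ffun kappa (f i)).
  move=> i j /ffunP eq_ij; apply: irr_inj; apply/cfunP=> x; rewrite -!iotaf.
  by congr (iota _); have := eq_ij x; rewrite !ffunE => /fmorph_inj.
pose sG := DecSocleType (regular_repr K G).
have K'G := pchar0_pgroup G charK.
have splitK : group_splitting_field K G by apply: group_closure_closed_field.
have char_rsim n1 n2 (rG1 : mx_representation K G n1) (rG2 : mx_representation K G n2) :
    mx_rsim rG1 rG2 -> char_of rG1 = char_of rG2.
  move=> sim12; apply/ffunP=> x; rewrite !ffunE; case: ifP => // Gx.
  exact: mxtrace_rsim.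
have irr_f i : is_irr_char G (map_ffun kappa (f i)).
  have [n [rG [irrG -> _]]] := fP i; exists n, (map_repr kappa rG).
  by rewrite char_of_map; split=> //; apply/mx_abs_irrW; rewrite map_mx_abs_irr.
have irr_comp_char n (rG : mx_representation K G n) : mx_irreducible rG ->
    char_of rG = char_of (irr_repr (irr_comp sG rG)).
  by move=> irrG; apply/char_rsim/rsim_irr_comp_pchar.
have /fin_all_exists[c cP] : forall i : Iirr G, exists c : sG,
    map_ffun kappa (f i) = char_of (irr_repr c).
  by move=> i; have [n [rG [irrG ->]]] := irr_f i; exists (irr_comp sG rG); apply: irr_comp_char.
have inj_c : injective c.
  by move=> i j eq_c; apply: inj_f; rewrite /= !cP eq_c.
have [c' _ cK] : bijective c.
  by apply: inj_card_bij => //; rewrite card_irr_pchar // card_ord NirrE.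
exists f; split=> // [i lin_i | chi].
  have [n [rG [irrG def_f chiE]]] := fP i.
  have n1 : n = 1%N.
    have := lin_char1 lin_i; rewrite -chiE def_f ffunE group1 repr_mx1 mxtrace1.
    by rewrite rmorph_nat => /eqP; rewrite pnatr_eq1 => /eqP.
  subst n.
  by exists (map_repr kappa rG); rewrite def_f char_of_map.
split=> [[n [rG [irrG ->]]] | [i ->]]; last exact: irr_f.
by exists (c' (irr_comp sG rG)); rewrite cP cK -irr_comp_char.
Qed.

(** * The Suzuki groups in Sp_4 *)

(** The centralizer of [b] meets U trivially, so its order is at most |B : U| = |T|. Conversely B /
    U is abelian, so the class of [b] lies in the coset b U and has at most |U| elements. *)
Lemma Frobenius_cent1_compl (gT : finGroupType) (B U T : {group gT}) b :
  [Frobenius B = U ><| T] -> abelian T -> b \in B :\: U -> #|'C_B[b]| = #|T|.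
Proof.
move=> frobB abT /setDP[Bb U'b]; have [defB _ _ _ _] := Frobenius_context frobB.
have [/andP[sUB nUB] _ _ _ _] := sdprod_context defB.
have cardB := sdprod_card defB.
have tiCU : 'C_B[b] :&: U = 1%g.
  apply/trivgP/subsetP=> u /setIP[/setIP[_ cub] Uu]; apply: contraR U'b => nt_u.
  have Uu1 : u \in U^# by rewrite !inE in nt_u *; rewrite nt_u.
  by rewrite (subsetP (Frobenius_cent1_ker frobB Uu1)) // inE Bb cent1C.
have B'U : B^`(1)%g \subset U.
  by rewrite der1_min // -(isog_abelian (sdprod_isog defB)).
have le1 : (#|'C_B[b]| * #|U| <= #|T| * #|U|)%N.
  by rewrite -(TI_cardMg tiCU) [(#|T| * _)%N]mulnC cardB subset_leq_card // mul_subG ?subsetIl.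
have le2 : (#|T| * #|U| <= #|'C_B[b]| * #|U|)%N.
  rewrite mulnC cardB -(Lagrange (subsetIl B 'C[b])) leq_mul2l index_cent1; apply/orP; right.
  rewrite -(card_lcoset U b) subset_leq_card //; apply/subsetP=> _ /imsetP[x Bx ->].
  by rewrite mem_lcoset (subsetP B'U) // derg1 -/(commg b x) mem_commg.
by apply/eqP; rewrite -(eqn_pmul2r (cardG_gt0 U)) eqn_leq le1 le2.
Qed.

Lemma sum_card_cent1 (gT : finGroupType) (B : {group gT}) :
  (\sum_(b in B) #|'C_B[b]| = #|classes B| * #|B|)%N.
Proof.
have actsB : [acts B, on B | 'J] by rewrite astabsJ normG.
have := Frobenius_Cauchy actsB.
rewrite (eq_bigr (fun b => #|'C_B[b]|)) => [->|b _]; last by rewrite afixJ cent_set1.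
by congr (#|pred_of_set _| * _)%N; apply: eq_imset => x; rewrite orbitJ.
Qed.

Section SuzukiMatrices.

Variables (m : nat) (m_gt0 : (0 < m)%N) (F : finFieldType).
Hypothesis cardF : #|F| = (2 ^ (2 * m).+1)%N.

(** [phi] is the field automorphism inside [steinberg]. On F its inverse is [sig], whose square is x
    |-> x^2. *)
Let phi (x : F) : F := x ^+ (2 ^ m).
Let sig (x : F) : F := x ^+ (2 ^ m.+1).

Let charF : 2 \in [pchar F] := suzuki_pchar cardF.
Let two0 : 2%:R = 0 :> F := suzuki_two0 cardF.

Let addxx (x : F) : x + x = 0. Proof. exact: addrr_pchar2. Qed.
Let oppx (x : F) : - x = x. Proof. exact: oppr_pchar2. Qed.
(** Makes [ring] usable in characteristic 2: the witness [z] is half the difference of the two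
    sides, computed as if over the integers. *)
Let eq_mod2 (x y z : F) : x = y + 2%:R * z -> x = y.
Proof. by rewrite two0 mul0r addr0. Qed.

Let phiD : {morph phi : x y / x + y} := suzuki_frobD cardF.
Let phiM : {morph phi : x y / x * y}. Proof. by move=> x y; exact: exprMn. Qed.
Let phi0 : phi 0 = 0. Proof. by rewrite /phi expr0n expn_eq0. Qed.
Let phi1 : phi 1 = 1. Proof. exact: expr1n. Qed.
Let sigE x : sig x = phi x ^+ 2. Proof. by rewrite /sig expnS mulnC exprM. Qed.
Let sigM : {morph sig : x y / x * y}. Proof. by move=> x y; exact: exprMn. Qed.
Let sqD (x y : F) : (x + y) ^+ 2 = x ^+ 2 + y ^+ 2.
Proof. by apply: (@eq_mod2 _ _ (x * y)); ring. Qed.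
Let sigD : {morph sig : x y / x + y}. Proof. by move=> x y; rewrite !sigE phiD sqD. Qed.
Let sig0 : sig 0 = 0. Proof. by rewrite sigE phi0 expr0n. Qed.
Let sig1 : sig 1 = 1. Proof. exact: expr1n. Qed.
Let sigV x : sig x^-1 = (sig x)^-1. Proof. exact: exprVn. Qed.

Let sigphi x : sig (phi x) = x.
Proof.
rewrite /sig /phi -exprM -expnD.
have -> : (m + m.+1 = (2 * m).+1)%N by lia.
by rewrite -cardF expf_card.
Qed.
Let phisig x : phi (sig x) = x.
Proof. by rewrite /sig /phi -exprM mulnC exprM [_ ^+ _ ^+ _]sigphi. Qed.
Let sigsig x : sig (sig x) = x ^+ 2. Proof. by rewrite sigE phisig. Qed.
Let sig_inj : injective sig. Proof. exact: can_inj phisig. Qed.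
Let sig_eq0 x : (sig x == 0) = (x == 0).
Proof. by rewrite -{1}sig0 (inj_eq sig_inj). Qed.
Let sqr_id (x : F) : x != 0 -> x ^+ 2 = x -> x = 1.
Proof. by move=> nz_x; rewrite expr2 => /(canRL (mulfK nz_x)); rewrite mulfV. Qed.
Let sig_id x : x != 0 -> sig x = x -> x = 1.
Proof. by move=> nz_x fix_x; apply: sqr_id => //; rewrite -sigsig !fix_x. Qed.

Let e (A : 'M[F]_4) (i j : nat) : F := A (inord i) (inord j).

Let e_eq (A B : 'M[F]_4) :
  (forall i j, (i < 4)%N -> (j < 4)%N -> e A i j = e B i j) -> A = B.
Proof.
move=> eqAB; apply/matrixP=> i j.
by have := eqAB i j (ltn_ord i) (ltn_ord j); rewrite /e !inord_val.
Qed.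

Let sum4 (f : 'I_4 -> F) :
  \sum_i f i = f (inord 0) + f (inord 1) + f (inord 2) + f (inord 3).
Proof.
rewrite !big_ord_recl big_ord0 addr0 !addrA.
by do !congr (_ + _); congr f; apply/val_inj; rewrite /= inordK.
Qed.

Let eM (A B : 'M[F]_4) i j :
  e (A *m B) i j = e A i 0 * e B 0 j + e A i 1 * e B 1 j + e A i 2 * e B 2 j + e A i 3 * e B 3 j.
Proof. by rewrite /e mxE sum4. Qed.

Let formE i j : (i < 4)%N -> (j < 4)%N -> e (sp4_form F) i j = (i + j == 3)%N%:R.
Proof. by move=> lti ltj; rewrite /e mxE !inordK. Qed.

(** The form on two rows of [A]. By [is_sp4_tr] the symplectic condition may be read on rows, which
    suits the action of G on row vectors. *)
Let dot (A : 'M[F]_4) i j :=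
  e A i 0 * e A j 3 + e A i 1 * e A j 2 + e A i 2 * e A j 1 + e A i 3 * e A j 0.

Let dotE (A : 'M[F]_4) i j : (i < 4)%N -> (j < 4)%N ->
  e (A *m sp4_form F *m A^T) i j = dot A i j.
Proof.
move=> lti ltj; rewrite !eM !formE //=.
have eT k : e A^T k j = e A j k by rewrite /e mxE.
by rewrite !eT /dot; ring.
Qed.

Let sp4_dot (A : 'M[F]_4) : is_sp4 A ->
  forall i j, (i < 4)%N -> (j < 4)%N -> dot A i j = (i + j == 3)%N%:R.
Proof.
move=> /is_sp4_tr; rewrite /is_sp4 trmxK => /eqP defA i j lti ltj.
by rewrite -dotE // defA formE.
Qed.

Let dot_sp4 (A : 'M[F]_4) :
  (forall i j, (i < 4)%N -> (j < 4)%N -> dot A i j = (i + j == 3)%N%:R) -> is_sp4 A.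
Proof.
move=> dotA; rewrite -[A]trmxK; apply: is_sp4_tr; rewrite /is_sp4 trmxK.
by apply/eqP/e_eq=> i j lti ltj; rewrite dotE // dotA // formE.
Qed.

Let pr (i : nat) := nth (0, 0)%N [:: (0, 1); (0, 2); (1, 3); (2, 3)]%N i.

Let minor (A : 'M[F]_4) i j :=
  phi (e A (pr i).1 (pr j).1) * phi (e A (pr i).2 (pr j).2)
  - phi (e A (pr i).1 (pr j).2) * phi (e A (pr i).2 (pr j).1).

Let steinbergE (A : 'M[F]_4) i j : (i < 4)%N -> (j < 4)%N ->
  e (steinberg m A) i j = minor A i j.
Proof.
move=> lti ltj; rewrite /e mxE /= !mxE /ext2_row !inordK //.
by case: i lti => [|[|[|[|]]]] // _; case: j ltj => [|[|[|[|]]]].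
Qed.

Let gT : finGroupType := {'GL_4[F]}.
Let G : {group gT} := suzuki cardF.
Let B : {group gT} := suzuki_borel cardF.
Let U : {group gT} := suzuki_unip cardF.
Let T : {group gT} := suzuki_torus cardF.

Let mx (g : gT) : 'M[F]_4 := GLval g.
Let mxM (x y : gT) : mx (x * y)%g = mx x *m mx y. Proof. by []. Qed.
Let mx1 : mx 1%g = 1%:M. Proof. by []. Qed.
Let mx_inj : injective mx. Proof. exact: val_inj. Qed.

Let suzP (g : gT) :
  reflect ((forall i j, (i < 4)%N -> (j < 4)%N -> dot (mx g) i j = (i + j == 3)%N%:R) /\
           (forall i j, (i < 4)%N -> (j < 4)%N -> minor (mx g) i j = e (mx g) i j))
          (g \in G).
Proof.
rewrite inE; apply: (iffP andP) => [[spg /eqP stg] | [dotg ming]].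
  by split; [exact: sp4_dot | move=> i j lti ltj; rewrite -steinbergE // stg].
split; first exact: dot_sp4.
by apply/eqP/e_eq=> i j lti ltj; rewrite steinbergE // ming.
Qed.

Let GL_of_sp4 (A : 'M[F]_4) :
    (forall i j, (i < 4)%N -> (j < 4)%N -> dot A i j = (i + j == 3)%N%:R) ->
    (forall i j, (i < 4)%N -> (j < 4)%N -> minor A i j = e A i j) ->
  exists2 g, g \in G & mx g = A.
Proof.
move=> dotA minA; have spA := dot_sp4 dotA.
have unitA : A \is a GRing.unit.
  have : sp4_form F *m A^T *m sp4_form F *m A = 1%:M.
    by rewrite -!mulmxA (mulmxA A^T) (eqP spA) sp4_form_sq.
  by move/mulmx1_unit => [].
by exists (FinRing.Unit unitA : gT); first apply/suzP.
Qed.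

Let phiV x : phi x^-1 = (phi x)^-1. Proof. exact: exprVn. Qed.
Let phi_eq0 x : (phi x == 0) = (x == 0). Proof. by rewrite expf_eq0 expn_gt0. Qed.

Let mk4 (s : seq (seq F)) : 'M[F]_4 := \matrix_(i, j) nth 0 (nth [::] s i) j.
Let mk4E s i j : (i < 4)%N -> (j < 4)%N -> e (mk4 s) i j = nth 0 (nth [::] s i) j.
Proof. by move=> lti ltj; rewrite /e mxE !inordK. Qed.

Let trigP (A : 'M[F]_4) :
  reflect (forall i j, (i < j < 4)%N -> e A i j = 0) (is_trig_mx A).
Proof.
apply: (iffP is_trig_mxP) => [tA i j /andP[ltij ltj] | tA i j ltij].
  by rewrite /e tA // !inordK // (ltn_trans ltij).
by rewrite -[A i j]/(A i j) -(inord_val i) -(inord_val j) -/(e A i j) tA // ltij ltn_ord.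
Qed.

Let diagP (A : 'M[F]_4) :
  reflect (forall i j, (i < 4)%N -> (j < 4)%N -> i != j -> e A i j = 0) (is_diag_mx A).
Proof.
apply: (iffP is_diag_mxP) => [tA i j lti ltj ne_ij | tA i j ne_ij].
  by rewrite /e tA // !inordK.
by rewrite -(inord_val i) -(inord_val j) -/(e A i j) tA.
Qed.

(** * Coordinates on the unipotent radical and the torus *)

Let ca (g : gT) := e (mx g) 1 0.
Let cb (g : gT) := e (mx g) 2 0.
Let cs (g : gT) := e (mx g) 1 1.

Let inU g : reflect [/\ g \in G, forall i j, (i < j < 4)%N -> e (mx g) i j = 0 &
   forall i, (i < 4)%N -> e (mx g) i i = 1] (g \in U).
Proof.
apply: (iffP setIP) => [[Gg] | [Gg tg ug]].
  rewrite inE => /andP[/trigP tg /forallP ug]; split=> // i lti.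
  exact/eqP/ug.
split=> //; rewrite inE; apply/andP; split; first exact/trigP.
by apply/forallP=> i; rewrite -(inord_val i); apply/eqP/ug.
Qed.

(** The entries below the diagonal other than [a] and [b] are forced by the form and the minors;
    they are derived in [unip_entries]. *)
Let unip_exists a b : exists2 g, g \in U & ca g = a /\ cb g = b.
Proof.
pose A := mk4 [:: [:: 1]; [:: a; 1]; [:: b; sig a; 1];
  [:: sig b + a * b + a * a * sig a; b + a * sig a; a; 1]].
have eA i j (lti : (i < 4)%N) (ltj : (j < 4)%N) : e A i j = _ := mk4E _ lti ltj.
have [||g Gg defg] := @GL_of_sp4 A.
- move=> i j; case: i => [|[|[|[|]]]] // _; case: j => [|[|[|[|]]]] // _;
  rewrite /dot !eA //=; try ring.
  + by apply: (@eq_mod2 _ _ a); ring.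
  + by apply: (@eq_mod2 _ _ (sig a)); ring.
  + by apply: (@eq_mod2 _ _ (b + a * sig a)); ring.
  + by apply: (@eq_mod2 _ _ a); ring.
  + by apply: (@eq_mod2 _ _ (b + a * sig a)); ring.
  by apply: (@eq_mod2 _ _ (sig b + a * b + a * a * sig a + (b + a * sig a) * a)); ring.
- move=> i j; case: i => [|[|[|[|]]]] // _; case: j => [|[|[|[|]]]] // _;
  rewrite /minor /= !eA //= ?phiD ?phiM ?phi1 ?phi0 ?phisig ?sigE; try ring.
  + by apply: (@eq_mod2 _ _ (- b)); ring.
  + by apply: (@eq_mod2 _ _ (- (a * b + a * a * phi a ^+ 2))); ring.
  by apply: (@eq_mod2 _ _ (- (b + a * phi a ^+ 2))); ring.
exists g; last by rewrite /ca /cb defg !eA.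
apply/inU; split=> // [i j | i]; rewrite defg.
  by case/andP; case: j => [|[|[|[|j]]]] //; case: i => [|[|[|[|i]]]] // _ _; rewrite eA.
by case: i => [|[|[|[|i]]]] //= _; rewrite eA.
Qed.

Let unip_entries g : g \in U -> let a := ca g in let b := cb g in
  [/\ e (mx g) 2 1 = sig a, e (mx g) 3 2 = a, e (mx g) 3 1 = b + a * sig a &
     e (mx g) 3 0 = a * (b + a * sig a) + sig b].
Proof.
case/inU=> /suzP[dotg ming] tg ug a b.
have e21 : e (mx g) 2 1 = sig a.
  have := ming 1%N 0%N isT isT; rewrite /minor /= (ug 0%N) // (tg 0%N 1%N) // phi0 phi1 mul0r mul1r subr0.
  by rewrite -/(ca g) -/a => <-; rewrite sigphi.
have e32 : e (mx g) 3 2 = a.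
  have := dotg 1%N 3%N isT isT.
  rewrite /dot /= (ug 3%N) // (ug 1%N) // (tg 1%N 2%N) // (tg 1%N 3%N) //.
  rewrite !mul0r !addr0 mulr1 mul1r.
  by move/eqP; rewrite addr_eq0 oppx => /eqP.
have e31 : e (mx g) 3 1 = b + a * sig a.
  have := dotg 2%N 3%N isT isT.
  rewrite /dot /= (ug 3%N) // (ug 2%N) // (tg 2%N 3%N) // mul0r addr0 mulr1 mul1r.
  by rewrite e21 e32 -/(cb g) -/b => /eqP; rewrite addr_eq0 oppx mulrC => /eqP.
split=> //; have := ming 2%N 0%N isT isT; rewrite /minor /= (ug 1%N) // phi1 mul1r e31.
rewrite -/(cb g) -/(ca g) -/a -/b -phiM => defb.
have -> : sig b = a * (b + a * sig a) + e (mx g) 3 0 by rewrite -{1}defb oppx sigD !sigphi.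
by rewrite addrA addxx add0r.
Qed.

Let unip_inj : {in U &, forall x y, ca x = ca y -> cb x = cb y -> x = y}.
Proof.
move=> x y Ux Uy eqa eqb; apply/mx_inj/e_eq.
have [x21 x32 x31 x30] := unip_entries Ux; have [y21 y32 y31 y30] := unip_entries Uy.
have [_ tx ux] := inU _ Ux; have [_ ty uy] := inU _ Uy.
move=> i j lti ltj.
case: (ltngtP i j) => [ltij | ltji | <-]; last by rewrite ux ?uy.
  by rewrite tx ?ty ?ltij.
case: i lti ltji => [|[|[|[|i]]]] // _; case: j ltj => [|[|[|[|j]]]] // _ _.
- by rewrite x21 y21 eqa.
- by rewrite x30 y30 eqa eqb.
- by rewrite x31 y31 eqa eqb.
by rewrite x32 y32 eqa.
Qed.

Let caM : {in U &, forall x y, ca (x * y)%g = ca x + ca y}.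
Proof.
move=> x y Ux Uy; rewrite {1}/ca mxM eM.
have [_ tx ux] := inU _ Ux; have [_ ty uy] := inU _ Uy.
by rewrite (tx 1%N 2%N) // (tx 1%N 3%N) // (ux 1%N) // (uy 0%N) // !mul0r !addr0 mulr1 mul1r.
Qed.

(** With [caM] this is the law (a, b)(a', b') = (a + a', b + b' + sig(a) a') of the Suzuki
    2-group. *)
Let cbM : {in U &, forall x y, cb (x * y)%g = cb x + cb y + sig (ca x) * ca y}.
Proof.
move=> x y Ux Uy; rewrite {1}/cb mxM eM.
have [_ tx ux] := inU _ Ux; have [_ ty uy] := inU _ Uy.
have [-> _ _ _] := unip_entries Ux.
by rewrite (tx 2%N 3%N) // (ux 2%N) // (uy 0%N) // -/(cb x) -/(ca y) -/(cb y); ring.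
Qed.

Let ca1 : ca 1%g = 0.
Proof. by rewrite /ca mx1 /e mxE -val_eqE /= !inordK. Qed.
Let cb1 : cb 1%g = 0.
Proof. by rewrite /cb mx1 /e mxE -val_eqE /= !inordK. Qed.

Let card_unip_sub (P : pred (F * F)) :
  #|[set x in U | P (ca x, cb x)]| = #|P|.
Proof.
have inj_c : {in [set x in U | P (ca x, cb x)] &, injective (fun x => (ca x, cb x))}.
  by move=> x y /setIdP[Ux _] /setIdP[Uy _] [eqa eqb]; apply: unip_inj.
rewrite -(card_in_imset inj_c); apply: eq_card => -[a b].
apply/imsetP/idP => [[x /setIdP[_ Px] ->] // | Pab].
have [g Ug [def_a def_b]] := unip_exists a b.
exists g; last by rewrite def_a def_b.
by apply/setIdP; rewrite def_a def_b.
Qed.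

Let card_unip : #|U| = ((2 ^ (2 * m).+1) ^ 2)%N.
Proof.
transitivity #|[set x in U | predT (ca x, cb x)]|.
  by apply: eq_card => x; rewrite [RHS]inE andbT.
by rewrite card_unip_sub -cardF -mulnn -card_prod; apply: eq_card.
Qed.

Let inT g : reflect (g \in G /\
    forall i j, (i < 4)%N -> (j < 4)%N -> i != j -> e (mx g) i j = 0) (g \in T).
Proof.
apply: (iffP setIP) => [[Gg] | [Gg dg]]; first by rewrite inE => /diagP.
by split=> //; rewrite inE; apply/diagP.
Qed.

(** The minor at (1, 1) of a diagonal fixed point requires phi(t / s) = s, whence t = s sig(s). *)
Let torus_exists s : s != 0 -> exists2 h, h \in T & cs h = s.
Proof.
move=> nz_s; pose t := s * sig s.
have nz_t : t != 0 by rewrite mulf_neq0 ?sig_eq0.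
pose A := mk4 [:: [:: t]; [:: 0; s]; [:: 0; 0; s^-1]; [:: 0; 0; 0; t^-1]].
have eA i j (lti : (i < 4)%N) (ltj : (j < 4)%N) : e A i j = _ := mk4E _ lti ltj.
have nz_ps : phi s != 0 by rewrite phi_eq0.
have [||g Gg defg] := @GL_of_sp4 A.
- move=> i j; case: i => [|[|[|[|]]]] // _; case: j => [|[|[|[|]]]] // _;
  by rewrite /dot !eA //=; first [ring | field; rewrite ?nz_t ?nz_s].
- move=> i j; case: i => [|[|[|[|]]]] // _; case: j => [|[|[|[|]]]] // _;
  rewrite /minor /= !eA //= /t ?phiV ?phiM ?phi1 ?phi0 ?phisig ?sigE; try ring;
  by field; rewrite ?nz_ps ?nz_s.
exists g; last by rewrite /cs defg eA.
apply/inT; split=> // i j; rewrite defg.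
case: i => [|[|[|[|]]]] // _; case: j => [|[|[|[|]]]] // _ _; by rewrite eA.
Qed.

Let torus_entries h : h \in T -> let s := cs h in
  [/\ s != 0, e (mx h) 0 0 = s * sig s, e (mx h) 2 2 = s^-1 &
     e (mx h) 3 3 = (s * sig s)^-1].
Proof.
case/inT=> /suzP[doth minh] dh s.
have h12 : s * e (mx h) 2 2 = 1.
  have := doth 1%N 2%N isT isT; rewrite /dot /=.
  by rewrite (dh 1%N 0%N) // (dh 1%N 2%N) // (dh 1%N 3%N) // !mul0r !addr0 add0r.
have h03 : e (mx h) 0 0 * e (mx h) 3 3 = 1.
  have := doth 0%N 3%N isT isT; rewrite /dot /=.
  by rewrite (dh 0%N 1%N) // (dh 0%N 2%N) // (dh 0%N 3%N) // !mul0r !addr0.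
have nz_s : s != 0 by apply: contra_eq_neq h12 => ->; rewrite mul0r eq_sym oner_eq0.
have h22 : e (mx h) 2 2 = s^-1 by rewrite -[RHS]mulr1 -h12 mulKf.
have h00 : e (mx h) 0 0 = s * sig s.
  have := minh 1%N 1%N isT isT; rewrite /minor /= (dh 0%N 2%N) // phi0 mul0r subr0 h22.
  rewrite -phiM -/(cs h) -/s => defs; rewrite -{2}defs sigphi mulrCA mulfV ?mulr1 //.
split=> //; rewrite -h00 -[RHS]mulr1 -h03 mulKf //.
by rewrite h00 mulf_neq0 ?sig_eq0.
Qed.

Let torus_inj : {in T &, injective cs}.
Proof.
move=> x y Tx Ty eqs; apply/mx_inj/e_eq.
have [nzx x0 x2 x3] := torus_entries Tx; have [nzy y0 y2 y3] := torus_entries Ty.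
have [_ dx] := inT _ Tx; have [_ dy] := inT _ Ty.
move=> i j lti ltj.
have [<-|ne_ij] := eqVneq i j; last by rewrite dx ?dy.
case: i lti => [|[|[|[|i]]]] // _.
- by rewrite x0 y0 eqs.
- by rewrite x2 y2 eqs.
by rewrite x3 y3 eqs.
Qed.

Let card_torus : #|T| = (2 ^ (2 * m).+1 - 1)%N.
Proof.
rewrite -(card_in_imset torus_inj) -cardF subn1 -(cardC1 (0 : F)); apply: eq_card => s.
rewrite !inE; apply/imsetP/idP => [[h Th ->] | nz_s].
  by have [] := torus_entries Th.
by have [h Th <-] := torus_exists nz_s; exists h.
Qed.

Let csM : {in T &, forall x y, cs (x * y)%g = cs x * cs y}.
Proof.
move=> x y /inT[_ dx] /inT[_ dy]; rewrite {1}/cs mxM eM.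
by rewrite (dx 1%N 0%N) // (dx 1%N 2%N) // (dx 1%N 3%N) // !mul0r !addr0 add0r.
Qed.

Let abelT : abelian T.
Proof.
apply/centsP=> x Tx y Ty; apply: torus_inj; rewrite ?groupM // !csM //.
exact: mulrC.
Qed.


Let inB g : reflect (g \in G /\ forall i j, (i < j < 4)%N -> e (mx g) i j = 0) (g \in B).
Proof.
apply: (iffP setIP) => [[Gg] | [Gg tg]]; first by rewrite inE => /trigP.
by split=> //; rewrite inE; apply/trigP.
Qed.

Let sUB : U \subset B.
Proof. by apply/subsetP=> g /inU[Gg tg _]; apply/inB. Qed.

Let sTB : T \subset B.
Proof.
apply/subsetP=> g /inT[Gg dg]; apply/inB; split=> // i j /andP[ltij ltj].
by rewrite dg ?(ltn_trans ltij) // neq_ltn ltij.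
Qed.

Let torus_diag h i : h \in T -> (i < 4)%N -> e (mx h) i i != 0.
Proof.
move=> Th; have [nz_s h0 h2 h3] := torus_entries Th.
case: i => [|[|[|[|i]]]] // _; rewrite ?h0 ?h2 ?h3 ?invr_eq0 ?mulf_neq0 ?sig_eq0 //.
Qed.

Let torus_mull h x i j : h \in T -> (i < 4)%N ->
  e (mx (h * x)%g) i j = e (mx h) i i * e (mx x) i j.
Proof.
case/inT=> _ dh lti; rewrite mxM eM.
case: i lti => [|[|[|[|i]]]] // _.
- by rewrite (dh 0%N 1%N) ?(dh 0%N 2%N) ?(dh 0%N 3%N) // !mul0r !addr0.
- by rewrite (dh 1%N 0%N) ?(dh 1%N 2%N) ?(dh 1%N 3%N) // !mul0r !addr0 add0r.
- by rewrite (dh 2%N 0%N) ?(dh 2%N 1%N) ?(dh 2%N 3%N) // !mul0r !addr0 !add0r.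
by rewrite (dh 3%N 0%N) ?(dh 3%N 1%N) ?(dh 3%N 2%N) // !mul0r !add0r.
Qed.

Let torus_mulr h x i j : h \in T -> (j < 4)%N ->
  e (mx (x * h)%g) i j = e (mx x) i j * e (mx h) j j.
Proof.
case/inT=> _ dh ltj; rewrite mxM eM.
case: j ltj => [|[|[|[|j]]]] // _.
- by rewrite (dh 1%N 0%N) ?(dh 2%N 0%N) ?(dh 3%N 0%N) // !mulr0 !addr0.
- by rewrite (dh 0%N 1%N) ?(dh 2%N 1%N) ?(dh 3%N 1%N) // !mulr0 !addr0 add0r.
- by rewrite (dh 0%N 2%N) ?(dh 1%N 2%N) ?(dh 3%N 2%N) // !mulr0 !addr0 !add0r.
by rewrite (dh 0%N 3%N) ?(dh 1%N 3%N) ?(dh 2%N 3%N) // !mulr0 !add0r.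
Qed.

Let torus_conj h x i j : h \in T -> (i < 4)%N -> (j < 4)%N ->
  e (mx h) i i * e (mx (x ^ h)%g) i j = e (mx x) i j * e (mx h) j j.
Proof. by move=> Th lti ltj; rewrite -torus_mull // -conjgC torus_mulr. Qed.

Let nUT : T \subset 'N(U).
Proof.
apply/subsetP=> h Th; rewrite inE; apply/subsetP=> _ /imsetP[x Ux ->].
have [Gx tx ux] := inU _ Ux; have [Gh _] := inT _ Th.
apply/inU; split=> [|i j /andP[ltij ltj] | i lti]; first by rewrite groupJ.
  have lti := ltn_trans ltij ltj.
  apply: (mulfI (torus_diag Th lti)).
  by rewrite torus_conj // tx ?ltij // mul0r mulr0.
by apply: (mulfI (torus_diag Th lti)); rewrite torus_conj // ux // mul1r mulr1.
Qed.

Let tiUT : U :&: T = 1%g.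
Proof.
apply/trivgP/subsetP=> x /setIP[Ux /inT[_ dx]]; rewrite inE; apply/eqP.
by apply: unip_inj; rewrite ?group1 // ?ca1 ?cb1 /ca /cb dx.
Qed.

Let defB : U ><| T = B.
Proof.
rewrite sdprodE //; apply/eqP; rewrite eqEsubset mul_subG //=.
apply/subsetP=> b /inB[Gb tb]; have [dotb minb] := suzP _ Gb.
set s := cs b.
have b12 : s * e (mx b) 2 2 = 1.
  have := dotb 1%N 2%N isT isT; rewrite /dot /= (tb 1%N 2%N) // (tb 1%N 3%N) //.
  by rewrite (tb 2%N 3%N) // !mul0r mulr0 !addr0 add0r.
have nz_s : s != 0 by apply: contra_eq_neq b12 => ->; rewrite mul0r eq_sym oner_eq0.
have b22 : e (mx b) 2 2 = s^-1 by rewrite -[RHS]mulr1 -b12 mulKf.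
have b00 : e (mx b) 0 0 = s * sig s.
  have := minb 1%N 1%N isT isT; rewrite /minor /= (tb 0%N 2%N) // phi0 mul0r subr0 b22.
  rewrite -phiM -/(cs b) -/s => defs; rewrite -{2}defs sigphi mulrCA mulfV ?mulr1 //.
have b33 : e (mx b) 3 3 = (s * sig s)^-1.
  have b03 : s * sig s * e (mx b) 3 3 = 1.
    have := dotb 0%N 3%N isT isT; rewrite /dot /= (tb 0%N 1%N) // (tb 0%N 2%N) //.
    by rewrite (tb 0%N 3%N) // !mul0r !addr0 b00.
  by rewrite -[RHS]mulr1 -b03 mulKf // mulf_neq0 ?sig_eq0.
have [h Th csh] := torus_exists nz_s; have [_ h0 h2 h3] := torus_entries Th.
rewrite csh in h0 h2 h3.
have Gh : h \in G by case: (inT _ Th).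
have defb i j : (j < 4)%N -> e (mx (b * h^-1)%g) i j * e (mx h) j j = e (mx b) i j.
  by move=> ltj; rewrite -torus_mulr // mulgKV.
apply/mulsgP; exists (b * h^-1)%g h => //; last by rewrite mulgKV.
apply/inU; split=> [|i j /andP[ltij ltj] | i lti]; first by rewrite groupM ?groupV.
  by apply: (mulIf (torus_diag Th ltj)); rewrite defb // tb ?ltij // mul0r.
apply: (mulIf (torus_diag Th lti)); rewrite defb // mul1r.
case: i lti => [|[|[|[|i]]]] // _; rewrite ?h0 ?h2 ?h3 //.
Qed.

Let sqr1_eq1 (x : F) : x ^+ 2 = 1 -> x = 1.
Proof. by move/eqP; rewrite sqrf_eq1 oppx orbb => /eqP. Qed.

(** Conjugation by the torus element with parameter s multiplies [ca] by sig(s) and [cb] by s^2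
    sig(s); either factor is 1 only for s = 1. *)
Let torus_reg : semiregular U T.
Proof.
move=> h /setD1P[nt_h Th]; apply/trivgP/subsetP=> x /setIP[Ux /cent1P cxh].
have [nz_s h0 h2 h3] := torus_entries Th.
have xh : (x ^ h)%g = x by rewrite conjgE cxh mulKg.
have s_neq1 : cs h != 1.
  apply: contraNneq nt_h => s1; apply/eqP; apply: torus_inj => //.
  by rewrite s1 /cs mx1 /e mxE eqxx.
rewrite inE; apply/eqP; apply: unip_inj; rewrite ?group1 // ?ca1 ?cb1.
  have := torus_conj x Th (isT : (1 < 4)%N) (isT : (0 < 4)%N).
  rewrite xh h0 -/(cs h) -/(ca x) mulrC => /eqP; rewrite -subr_eq0 -mulrBr mulf_eq0.
  case/orP=> [/eqP // | ]; rewrite -{1}[cs h]mulr1 -mulrBr mulf_eq0 (negPf nz_s) /=.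
  by rewrite subr_eq0 eq_sym -{1}sig1 => /eqP/sig_inj s1; rewrite s1 eqxx in s_neq1.
have := torus_conj x Th (isT : (2 < 4)%N) (isT : (0 < 4)%N).
rewrite xh h0 h2 -/(cb x) mulrC => /eqP; rewrite -subr_eq0 -mulrBr mulf_eq0.
case/orP=> [/eqP // | ]; rewrite subr_eq0 => /eqP/(congr1 ( *%R (cs h))).
rewrite mulfV // => s3.
(* Applying [sig] to s^2 sig(s) = 1 gives sig(s)^2 s^2 = 1, so s sig(s) = 1, and dividing the two
   relations gives s = 1. *)
have sv1 : cs h * sig (cs h) = 1.
  apply: sqr1_eq1; have := congr1 sig s3; rewrite !sigM sigsig sig1 => ->; ring.
by case/eqP: s_neq1; rewrite s3 sv1 mulr1.
Qed.

(** * The Weyl involution and the Bruhat decomposition *)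

Let weyl_exists : exists2 w, w \in G & mx w = sp4_form F.
Proof.
apply: GL_of_sp4.
  by move=> i j; case: i => [|[|[|[|]]]] // _; case: j => [|[|[|[|]]]] // _;
    rewrite /dot !formE //=; ring.
move=> i j; case: i => [|[|[|[|]]]] // _; case: j => [|[|[|[|]]]] // _;
  rewrite /minor /= !formE //= ?phi0 ?phi1; try ring.
all: by apply: (@eq_mod2 _ _ (- 1)); ring.
Qed.

(** The first row of [g] spans a point of the Suzuki ovoid. The plane x_3 = 0 is tangent to the
    ovoid at e_0 and contains no other point of it. *)
Let row0_tail (g : gT) : g \in G -> e (mx g) 0 3 = 0 ->
  e (mx g) 0 1 = 0 /\ e (mx g) 0 2 = 0.
Proof.
case/suzP=> dotg ming; have d01 := dotg 0%N 1%N isT isT.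
have m1 := ming 0%N 1%N isT isT; have m2 := ming 0%N 2%N isT isT.
have m3 := ming 0%N 3%N isT isT.
rewrite /minor /= in m1 m2 m3; rewrite -!phiM in m1 m2 m3; rewrite /dot /= in d01.
move: d01 m1 m2 m3; set x0 := e _ 0 0; set x1 := e _ 0 1; set x2 := e _ 0 2.
set x3 := e _ 0 3; set y0 := e _ 1 0; set y1 := e _ 1 1; set y2 := e _ 1 2; set y3 := e _ 1 3.
move=> d01 m1 m2 m3 z3; rewrite z3 !mul0r ?phi0 ?subr0 ?sub0r ?addr0 in d01 m1 m2 m3.
have x2_0 : x2 = 0.
  apply: contraTeq isT => nz_x2; move/eqP: m3; rewrite phi_eq0 mulf_eq0 (negPf nz_x2) /=.
  by move/eqP=> y30; move/eqP: m2; rewrite y30 mulr0 phi0 eq_sym (negPf nz_x2).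
split=> //; apply: contraTeq isT => nz_x1.
have y30 : y3 = 0.
  by move/eqP: m2; rewrite x2_0 phi_eq0 mulf_eq0 (negPf nz_x1) /= => /eqP.
have y20 : y2 = 0.
  by move/eqP: d01; rewrite y30 x2_0 mul0r mulr0 add0r addr0 mulf_eq0 (negPf nz_x1) => /eqP.
by move/eqP: m1; rewrite y20 x2_0 mulr0 mul0r phi0 subrr eq_sym (negPf nz_x1).
Qed.

Let row0_head (g : gT) : g \in G ->
    e (mx g) 0 1 = 0 -> e (mx g) 0 2 = 0 -> e (mx g) 0 3 != 0 ->
  e (mx g) 0 0 = 0.
Proof.
case/suzP=> dotg ming z1 z2 nz3.
have := ming 0%N 1%N isT isT; have := ming 0%N 3%N isT isT.
rewrite /minor /= -!phiM z1 z2 !mul0r phi0 sub0r subr0 oppx => m3 m1.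
have nzy : e (mx g) 1 2 != 0.
  by apply: contraNneq nz3 => y2; rewrite -m3 y2 mulr0 phi0.
by move/eqP: m1; rewrite phi_eq0 mulf_eq0 (negPf nzy) orbF => /eqP.
Qed.

(** B is the stabilizer in G of the line spanned by e_0. *)
Let row0_borel (g : gT) : g \in G -> e (mx g) 0 1 = 0 ->
  e (mx g) 0 2 = 0 -> e (mx g) 0 3 = 0 -> g \in B.
Proof.
move=> Gg z1 z2 z3; have [dotg ming] := suzP _ Gg.
have nz0 : e (mx g) 0 0 != 0.
  have := dotg 0%N 3%N isT isT; rewrite /dot z1 z2 z3 !mul0r !addr0 /=.
  by apply: contra_eq_neq => ->; rewrite mul0r eq_sym oner_eq0.
have col3 j : (0 < j < 3)%N -> e (mx g) j 3 = 0.
  case/andP=> j_gt0 ltj; have := dotg 0%N j isT (ltnW ltj).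
  rewrite /dot z1 z2 z3 !mul0r !addr0 add0n (ltn_eqF ltj) => /eqP.
  by rewrite mulf_eq0 (negPf nz0) => /eqP.
have e12 : e (mx g) 1 2 = 0.
  have := ming 0%N 1%N isT isT; rewrite /minor /= -!phiM z1 z2 mul0r phi0 subr0 => /eqP.
  by rewrite phi_eq0 mulf_eq0 (negPf nz0) => /eqP.
apply/inB; split=> // i j /andP[].
by case: j => [|[|[|[|j]]]] //; case: i => [|[|[|[|i]]]] // _ _; rewrite ?col3.
Qed.

Section Weyl.

Variable w : gT.
Hypotheses (Gw : w \in G) (def_w : mx w = sp4_form F).

Let weyl_mulr g i j : (j < 4)%N -> e (mx (g * w)%g) i j = e (mx g) i (3 - j).
Proof.
move=> ltj; rewrite mxM def_w eM !formE //.
by case: j ltj => [|[|[|[|j]]]] // _; rewrite /= ?mulr0 ?mulr1 ?addr0 ?add0r.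
Qed.

Let weyl_mull g i j : (i < 4)%N -> e (mx (w * g)%g) i j = e (mx g) (3 - i) j.
Proof.
move=> lti; rewrite mxM def_w eM !formE //.
by case: i lti => [|[|[|[|i]]]] // _; rewrite /= ?mul0r ?mul1r ?addr0 ?add0r.
Qed.

Lemma weyl_invol : (w * w = 1)%g.
Proof.
by apply: mx_inj; rewrite mxM def_w sp4_form_sq mx1.
Qed.

Let weylV : w^-1%g = w := involV weyl_invol.

Let weyl_conj g i j : (i < 4)%N -> (j < 4)%N ->
  e (mx (g ^ w)%g) i j = e (mx g) (3 - i) (3 - j).
Proof. by move=> lti ltj; rewrite conjgE weylV weyl_mull // weyl_mulr. Qed.

Lemma weyl_inv : {in T, forall t, t ^ w = t^-1}%g.
Proof.
move=> t Tt; have [Gt dt] := inT _ Tt; have [nz_s _ t2 _] := torus_entries Tt.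
have Ttw : (t ^ w)%g \in T.
  apply/inT; split=> [|i j lti ltj ne_ij]; first by rewrite groupJ.
  by rewrite weyl_conj // dt ?ltnS ?leq_subr //; move: ne_ij lti ltj; clear; lia.
have TtV : t^-1%g \in T by rewrite groupV.
apply: (torus_inj Ttw TtV); apply: (mulfI nz_s).
rewrite -(csM Tt TtV) mulgV {2}/cs weyl_conj // t2 mulfV //.
by rewrite /cs mx1 /e mxE eqxx.
Qed.

Lemma torus_weyl : B :&: B :^ w = T.
Proof.
apply/setP=> b; rewrite inE mem_conjg weylV; apply/andP/idP=> [[Bb Bbw] | Tb].
  have [Gb tb] := inB _ Bb; have [_ tbw] := inB _ Bbw; apply/inT; split=> // i j lti ltj.
  rewrite neq_ltn => /orP[ltij | ltji]; first by rewrite tb ?ltij.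
  have := tbw (3 - i)%N (3 - j)%N; rewrite weyl_conj ?ltnS ?leq_subr // !subKn //; apply.
  by move: ltji lti; clear; lia.
have Bb := subsetP sTB b Tb; have BVb : b^-1%g \in B := groupVr Bb.
by rewrite (weyl_inv Tb) Bb BVb.
Qed.

Lemma weyl_bruhat : {in G, forall g, g \notin B ->
  exists b u, [/\ b \in B, u \in U & g = b * w * u]%g}.
Proof.
move=> g Gg B'g.
have nz3 : e (mx g) 0 3 != 0.
  by apply: contra B'g => /eqP z3; have [z1 z2] := row0_tail Gg z3; apply: row0_borel.
set x1 := e (mx g) 0 1; set x2 := e (mx g) 0 2; set x3 := e (mx g) 0 3 in nz3 *.
(* These values solve x2 + x3 a = 0 and x1 + x2 sig(a) + x3 (b + a sig(a)) = 0, so right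
   multiplication by [u] clears the entries 1 and 2 of the first row. Entry 0 then vanishes by
   [row0_head], and [w] moves the remaining entry to the front. *)
pose a := x2 / x3; pose b := (x1 + x2 * sig a) / x3 + a * sig a.
have [u Uu [def_a def_b]] := unip_exists a b.
have [Gu tu uu] := inU _ Uu; have := unip_entries Uu.
rewrite /= def_a def_b => -[u21 u32 u31 _].
have Ggu : (g * u)%g \in G by rewrite groupM.
have gu3 : e (mx (g * u)%g) 0 3 = x3.
  rewrite mxM eM (tu 0%N 3%N) // (tu 1%N 3%N) // (tu 2%N 3%N) // (uu 3%N) //.
  by rewrite !mulr0 !add0r mulr1.
have gu2 : e (mx (g * u)%g) 0 2 = 0.
  rewrite mxM eM (tu 0%N 2%N) // (tu 1%N 2%N) // (uu 2%N) // u32.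
  by rewrite !mulr0 !add0r mulr1 -/x2 -/x3 /a mulrC divfK // addxx.
have gu1 : e (mx (g * u)%g) 0 1 = 0.
  rewrite mxM eM (tu 0%N 1%N) // (uu 1%N) // u21 u31 -/x1 -/x2 -/x3.
  have -> : b + a * sig a = (x1 + x2 * sig a) / x3 by rewrite /b -addrA addxx addr0.
  by rewrite mulr0 add0r mulr1 [x3 * _]mulrC divfK // addxx.
have gu0 : e (mx (g * u)%g) 0 0 = 0 by apply: row0_head; rewrite ?gu3.
have Bguw : (g * u * w)%g \in B.
  by apply: row0_borel; rewrite ?groupM // weyl_mulr.
exists (g * u * w)%g, u^-1%g; split; first exact: Bguw.
  exact: (groupVr Uu).
by rewrite -(mulgA (g * u)%g) weyl_invol mulg1 mulgK.
Qed.

End Weyl.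

(** * Conjugacy classes of B and the derived subgroup of U *)

Let card_gt2 : (2 < #|F|)%N.
Proof. by rewrite cardF -[2%N]/(2 ^ 1)%N ltn_exp2l //; move: m_gt0; clear; lia. Qed.

Let q := #|F|.

Let frobB : [Frobenius B = U ><| T].
Proof.
apply/(Frobenius_semiregularP defB); rewrite -?cardG_gt1.
- by rewrite card_unip -cardF -[1%N](exp1n 2) ltn_exp2r // ltnW.
- by rewrite card_torus -cardF ltn_subRL.
exact: torus_reg.
Qed.

Let unip_comm x y : x \in U -> y \in U ->
  (y \in 'C[x]) = (sig (ca x) * ca y == sig (ca y) * ca x).
Proof.
move=> Ux Uy; apply/cent1P/eqP => [cxy | eq_xy].
  by have := congr1 cb cxy; rewrite !cbM // [cb y + cb x]addrC => /addrI.
apply: unip_inj; rewrite ?groupM // ?caM ?cbM //; first exact: addrC.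
by rewrite eq_xy [cb y + cb x]addrC.
Qed.

Let card_cent_center x : x \in U -> ca x = 0 -> #|'C_U[x]| = (q ^ 2)%N.
Proof.
move=> Ux ax; rewrite /q cardF -card_unip; apply: eq_card => y.
apply/setIP/idP=> [[]//|Uy]; split=> //.
by rewrite unip_comm // ax sig0 mulr0 mul0r eqxx.
Qed.

(** An element [y] of U commutes with [x] when [ca y / a] is fixed by [sig], and [sig] fixes only 0
    and 1. This leaves two values for [ca y] and q for [cb y]. *)
Let card_cent_noncenter x : x \in U -> ca x != 0 -> #|'C_U[x]| = (2 * q)%N.
Proof.
move=> Ux nz_a; set a := ca x in nz_a *.
pose P (p : F * F) := (p.1 == 0) || (p.1 == a).
have <- : #|P| = (2 * q)%N.
  rewrite (_ : #|P| = #|[predX pred2 0 a & F]|); first by rewrite cardX card2 eq_sym nz_a.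
  by apply: eq_card => p; rewrite !inE andbT.
rewrite -(card_unip_sub P); apply: eq_card => y.
apply/setIP/setIdP=> [] [Uy]; rewrite ?unip_comm // -/a /P /=; last first.
  by case/orP=> /eqP->; rewrite ?sig0 ?mulr0 ?mul0r eqxx.
move=> cxy; split=> //; have [//|nz_y /=] := eqVneq (ca y) 0.
have z1 : ca y / a = 1.
  apply: sig_id; first by rewrite mulf_neq0 ?invr_eq0.
  by rewrite sigM sigV; apply/eqP; rewrite eqr_div ?sig_eq0 // eq_sym mulrC.
by rewrite -[ca y](divfK nz_a) z1 mul1r.
Qed.

Let cardB : #|B| = (q ^ 2 * (q - 1))%N.
Proof. by rewrite -(sdprod_card defB) card_unip card_torus /q cardF. Qed.

Let card_cent1_unip x : x \in U -> x != 1%g -> #|'C_B[x]| = #|'C_U[x]|.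
Proof.
move=> Ux nt_x; have U1x : x \in U^# by apply/setD1P.
have sCU := Frobenius_cent1_ker frobB U1x.
apply: eq_card => y; apply/setIP/setIP=> [] [Xy Cy]; split=> //.
  by apply: (subsetP sCU); apply/setIP.
exact: (subsetP sUB).
Qed.

Let sum_center : (\sum_(x in U^#) #|'C_B[x]| = (q - 1) * q ^ 2 + (q ^ 2 - q) * (2 * q))%N.
Proof.
pose P (p : F * F) := p.1 == 0.
pose Z := [set x in U | P (ca x, cb x)].
have cardZ : #|Z| = q.
  rewrite card_unip_sub (_ : #|P| = #|[predX pred1 (0 : F) & F]|).
    by rewrite cardX card1 mul1n.
  by apply: eq_card => p; rewrite !inE andbT.
have ZP x : reflect (x \in U /\ ca x = 0) (x \in Z).
  by apply: (iffP setIdP) => [] [Ux /eqP].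
have sZU : Z \subset U by apply/subsetP=> x /ZP[].
have Z1 : 1%g \in Z by apply/ZP; rewrite group1 ca1.
rewrite (big_setID Z) /=; congr (_ + _)%N.
  rewrite setIDAC (setIidPr sZU).
  rewrite (eq_bigr (fun=> (q ^ 2)%N)) => [|x /setD1P[nt_x /ZP[Ux ax]]]; last first.
    by rewrite card_cent1_unip ?card_cent_center.
  by rewrite sum_nat_const; congr (_ * _)%N; rewrite -cardZ [in RHS](cardsD1 1%g) Z1 add1n subn1.
have -> : U^# :\: Z = U :\: Z.
  by rewrite setDDl (setUidPr _) // sub1set.
rewrite (eq_bigr (fun=> (2 * q)%N)) => [|x /setDP[Ux Z'x]]; last first.
  have nz_a : ca x != 0 by apply: contra Z'x => /eqP ax; apply/ZP.
  rewrite card_cent1_unip ?card_cent_noncenter //.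
  by apply: contraNneq Z'x => ->.
by rewrite sum_nat_const cardsD (setIidPr sZU) cardZ card_unip /q cardF.
Qed.

(** In units of |B| = q^2 (q - 1), the centralizer orders add up to 1 for the identity, 1 + 2 for
    the rest of U, and q - 2 for B outside U. *)
Let classesB : #|classes B| = (q + 2)%N.
Proof.
apply/eqP; rewrite -(eqn_pmul2r (cardG_gt0 B)) -sum_card_cent1 (big_setID U) /=.
have -> : (\sum_(x in B :&: U) #|'C_B[x]| =
    #|B| + ((q - 1) * q ^ 2 + (q ^ 2 - q) * (2 * q)))%N.
  rewrite (setIidPr sUB) (big_setD1 1%g (group1 U));  congr (_ + _)%N; last exact: sum_center.
  by rewrite cent11T setIT.
rewrite cardB.
rewrite (eq_bigr (fun=> (q - 1)%N)) => [|b B'b]; last first.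
  by rewrite (Frobenius_cent1_compl frobB abelT B'b) card_torus /q cardF.
rewrite sum_nat_const cardsD (setIidPr sUB) cardB card_unip -cardF -/q.
have [r ->] : exists r, q = r.+2 by exists q.-2; rewrite /q; move: card_gt2; clear; lia.
apply/eqP; rewrite !subn1 /= -[(r.+2 ^ 2)%N]/(r.+2 * r.+2)%N.
have -> : (r.+2 * r.+2 * r.+1 - r.+2 * r.+2 = r.+2 * r.+2 * r)%N by rewrite mulnS addKn.
have -> : (r.+2 * r.+2 - r.+2 = r.+2 * r.+1)%N by rewrite [RHS]mulnS mulnS addKn mulnS.
ring.
Qed.

(** If z sig(z) = 1, then z^2 = sig(sig(z)) = z. As F is finite, a sig(a) = c is thus solvable for
    every c. *)
Let norm_inj : injective (fun x => x * sig x).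
Proof.
move=> x y /= eq_xy; have [x0 | nz_x] := eqVneq x 0.
  move/eqP: eq_xy; rewrite x0 mul0r eq_sym mulf_eq0 sig_eq0 orbb => /eqP-> //.
have nz_y : y != 0.
  by apply: contraNneq nz_x => y0; have := mulf_eq0 x (sig x); rewrite sig_eq0 orbb eq_xy y0 mul0r eqxx => <-.
have zs : (x / y) * sig (x / y) = 1.
  by rewrite sigM sigV mulrACA -invfM eq_xy mulfV // mulf_neq0 ?sig_eq0.
have nz_z : x / y != 0 by rewrite mulf_neq0 ?invr_eq0.
have zsV : sig (x / y) = (x / y)^-1 by rewrite -[RHS]mulr1 -zs mulKf.
have z1 : x / y = 1.
  apply: sqr_id => //; rewrite -sigsig zsV sigV zsV invrK //.
by rewrite -(divfK nz_y x) z1 mul1r.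
Qed.

(** The elements (a, 0) and (a t, 0) have commutator (0, a sig(a) (t + sig(t))). For [t] outside F_2
    the last factor is nonzero, so a suitable [a] reaches every z with [ca z = 0]. *)
Let center_der z : z \in U -> ca z = 0 -> z \in U^`(1)%g.
Proof.
move=> Uz az.
have [t nz_t nt_t] : exists2 t : F, t != 0 & t != 1.
  have /card_gt0P[t] : (0 < #|[predC pred2 0%R (1%R : F)]|)%N.
    rewrite -(ltn_add2l #|pred2 0%R (1%R : F)|) [X in (_ < X)%N](cardC (pred2 0%R (1%R : F))).
    by rewrite addn0 card2 eq_sym oner_eq0; exact: card_gt2.
  by rewrite !inE negb_or => /andP[]; exists t.
have nz_ts : t + sig t != 0.
  apply: contra nt_t => /eqP ts0; apply/eqP/sig_id => //.
  by apply/eqP; rewrite -subr_eq0 oppx addrC ts0.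
have [g _ normK] := injF_bij norm_inj.
pose a := g (cb z / (t + sig t)).
have [x Ux [ax bx]] := unip_exists a 0; have [y Uy [ay by_]] := unip_exists (a * t) 0.
have zE : (x * y = y * x * z)%g.
  have Uyx : (y * x)%g \in U by rewrite groupM.
  apply: unip_inj; rewrite ?groupM // ?caM ?cbM // ?caM // ?cbM // ?ax ?ay ?bx ?by_ ?az.
    by rewrite addr0 addrC.
  rewrite !sigM !add0r.
  have eq_a : a * sig a * (t + sig t) = cb z by rewrite /a normK divfK.
  rewrite -eq_a ?sig0 ?mulr0 ?addr0.
  by apply: (@eq_mod2 _ _ (- (a * sig a * sig t))); ring.
rewrite derg1 (_ : z = [~ x, y]%g) ?mem_commg // commgEl conjgE.
by rewrite zE -[(y * x * z)%g]mulgA !mulKg.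
Qed.

Lemma suzuki_is_suzuki_like : exists w,
  suzuki_like m (suzuki cardF) (suzuki_borel cardF) (suzuki_unip cardF) (suzuki_torus cardF) w.
Proof.
have [w Gw def_w] := weyl_exists; exists w.
split; [split | exact: m_gt0 | exact: card_unip | exact: card_torus | exact: abelT | | ].
- exact: subsetIl.
- exact: frobB.
- exact: (weyl_bruhat Gw def_w).
- exact: Gw.
- exact: (weyl_invol def_w).
- exact: (weyl_inv Gw def_w).
- exact: (torus_weyl Gw def_w).
- by rewrite -cardF; exact: classesB.
by move=> u Uu; apply: center_der; rewrite ?groupM // caM // addxx.
Qed.

End SuzukiMatrices.

(** * Harish-Chandra induction over K *)

Section CharMap.

Variables (L K : fieldType) (f : {rmorphism L -> K}) (gT : finGroupType).

Lemma char_Ind_map (G H : {group gT}) (phi : {ffun gT -> L}) :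
  map_ffun f (char_Ind G H phi) = char_Ind G H (map_ffun f phi).
Proof.
apply/ffunP=> x; rewrite 3!ffunE; case: ifP => _; last exact: rmorph0.
rewrite rmorphM fmorphV rmorph_nat rmorph_sum; congr (_ * _).
by apply: eq_bigr => y _; rewrite ffunE.
Qed.

Lemma char_Infl_map (B U T : {group gT}) (lam : {ffun gT -> L}) :
  map_ffun f (char_Infl B U T lam) = char_Infl B U T (map_ffun f lam).
Proof.
apply/ffunP=> x; rewrite 3!ffunE; case: ifP => _; last exact: rmorph0.
by rewrite ffunE.
Qed.

End CharMap.

Section Characters.

Variables (K : fieldType) (gT : finGroupType).
Implicit Types (G H B U T : {group gT}) (chi phi lam : {ffun gT -> K}).

Lemma is_linear_char_Infl B U T lam : U ><| T = B ->
  is_linear_char T lam -> is_linear_char B (char_Infl B U T lam).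
Proof.
move=> defB [rT def_lam]; have [nsUB _ _ _ _] := sdprod_context defB.
have complT : T \in [complements to U in B] by rewrite (sdprod_compl defB).
have remT x : x \in B -> remgr U T x \in T.
  by rewrite -{1}(sdprodW defB); apply: mem_remgr.
have rP : mx_repr B (fun b => rT (remgr U T b)).
  split=> [|x y Bx By]; last by rewrite (remgrM complT nsUB) ?repr_mxM ?remT.
  by rewrite remgr1 ?group1 ?repr_mx1.
exists (MxRepresentation rP); rewrite def_lam; apply/ffunP=> x.
by rewrite 3!ffunE; case: ifP => // /remT->.
Qed.

Lemma imprimitive_index G chi : [pchar K] =i pred0 -> imprimitive G chi ->
  exists H n, [/\ H \proper G, chi 1%g = n%:R & #|G : H| %| n]%N.
Proof.
move=> charK [_ [H [_ [ltHG [n [rH ->]] ->]]]].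
exists H, (#|G : H| * n)%N; rewrite dvdn_mulr //; split=> //.
rewrite ffunE group1 (eq_bigr (fun=> n%:R)) => [|y _]; last first.
  by rewrite ffunE conj1g group1 repr_mx1 mxtrace1.
have nzH : #|H|%:R != 0 :> K by rewrite ((pcharf0P K).1 charK) -lt0n cardG_gt0.
rewrite sumr_const -[#|G|](Lagrange (proper_sub ltHG)) -[n%:R *+ _]mulr_natl natrM -mulrA.
by rewrite mulKf // natrM.
Qed.

End Characters.

(** Modulo q - 1 the number q^2 + 1 is 2, so it is no multiple of q - 1 >= 7. This lets [XS] be
    recognized by its degree alone. *)
Lemma suzuki_like_char_degree (m : nat) (gT : finGroupType) (G B U T : {group gT}) w
    (suzG : suzuki_like m G B U T w) (q := (2 ^ (2 * m).+1)%N) (d := (2 ^ m)%N) n :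
  n = 1%N \/ n = (q ^ 2)%N \/ [\/ n = (q - 1) * d, n = (q - 1) * (q + 1 - 2 * d) |
       n = (q - 1) * (q + 1 + 2 * d)]%N -> n != (q ^ 2 + 1)%N.
Proof.
have q_ge8 : (8 <= q)%N.
  by rewrite -[8%N]/(2 ^ 3)%N leq_exp2l //; have := suz_exp suzG; clear; lia.
have q2 : (q ^ 2 + 1 = (q - 1) * (q + 1) + 2)%N by rewrite -mulnn; nia.
have ndvd c : ((q - 1) * c)%N != (q ^ 2 + 1)%N.
  apply/eqP=> e; have : (q - 1 %| 2)%N.
    by rewrite -(dvdn_addr 2 (dvdn_mulr (q + 1) (dvdnn (q - 1)))) -q2 -e dvdn_mulr.
  by move/dvdn_leq => /(_ isT); move: q_ge8; clear; lia.
case=> [->|[->|[]->]]; rewrite ?ndvd //.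
  by rewrite eq_sym -[1%N]add0n eqn_add2r -lt0n expn_gt0 (leq_trans _ q_ge8).
by rewrite -[X in X != _]addn0 eqn_add2l.
Qed.

Section Transfer.

Variables (K : closedFieldType) (charK : [pchar K] =i pred0).
Variables (m : nat) (gT : finGroupType) (G B U T : {group gT}) (w : gT).
Hypothesis suzG : suzuki_like m G B U T w.

Let q := (2 ^ (2 * m).+1)%N.

Lemma suzuki_like_characters :
  [/\ forall chi : {ffun gT -> K},
        imprimitive G chi <->
        is_irr_char G chi /\ chi 1%g = (q ^ 2 + 1)%N%:R,
      forall chi : {ffun gT -> K},
        is_irr_char G chi -> chi 1%g = (q ^ 2 + 1)%N%:R ->
        exists lam : {ffun gT -> K},
          [/\ is_linear_char T lam,
              is_linear_char B (char_Infl B U T lam)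
            & chi = HC_Ind G B U T lam],
      has_exactly
        (fun chi : {ffun gT -> K} => is_irr_char G chi) (q + 3)%N
    & has_exactly
        (fun chi : {ffun gT -> K} => imprimitive G chi)
        (q %/ 2 - 1)%N].
Proof.
have natK n n' : (n%:R == n'%:R :> K) = (n == n').
  wlog le_nn' : n n' / (n <= n')%N.
    by move=> IH; case: (leqP n n') => [/IH// | /ltnW/IH]; rewrite eq_sym => ->; rewrite eq_sym.
  by rewrite eq_sym -subr_eq0 -natrB // ((pcharf0P K).1 charK) subn_eq0 eqn_leq le_nn'.
have [L [iota [kappa trK]]] := irr_char_transfer gT charK.
have [f [fE _ f_inj f_irr]] := trK G; have [fT [fTE fT_lin _ _]] := trK T.
have [XS [cardI cardXS XS_P] XS'_P] := suzuki_irr suzG.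
have degE i n : 'chi[G]_i 1%g = n%:R -> map_ffun kappa (f i) 1%g = n%:R.
  move=> def_n; rewrite ffunE -[RHS](rmorph_nat kappa); congr (kappa _).
  by apply: (fmorph_inj iota); rewrite fE rmorph_nat.
have sBG := rk1_sub (suz_rk1 suzG).
have degP i : map_ffun kappa (f i) 1%g = (q ^ 2 + 1)%N%:R -> i \in XS.
  move=> /eqP; apply: contraTT => XS'i.
  have [n /degE-> n_spec] : exists2 n, 'chi[G]_i 1%g = n%:R &
      n = 1%N \/ n = (q ^ 2)%N \/ [\/ n = (q - 1) * 2 ^ m,
        n = (q - 1) * (q + 1 - 2 * 2 ^ m) | n = (q - 1) * (q + 1 + 2 * 2 ^ m)]%N.
    have [->|nz_i] := eqVneq i 0; first by exists 1%N; [rewrite irr0 cfun11 | left].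
    by have [n Dn n_spec] := XS'_P i XS'i nz_i; exists n; last right.
  by rewrite natK (suzuki_like_char_degree suzG).
have HC_P (chi : {ffun gT -> K}) : is_irr_char G chi -> chi 1%g = (q ^ 2 + 1)%N%:R ->
    exists lam : {ffun gT -> K}, [/\ is_linear_char T lam,
      is_linear_char B (char_Infl B U T lam) & chi = HC_Ind G B U T lam].
  move/f_irr=> [i ->] /degP/XS_P[_ [D [t def_i]]].
  have linT := fT_lin t (lin_charT suzG t).
  exists (map_ffun kappa (fT t)); split; [exact: linT | exact: is_linear_char_Infl | ].
  rewrite /HC_Ind -char_Infl_map -char_Ind_map; congr (map_ffun _ _).
  (* The identity is one over L, so it may be checked in [algC], where the class functions of the
     library apply, and then carried to K by [kappa]. *)
  apply/ffunP=> x; apply: (fmorph_inj iota).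
  have -> : iota (char_Ind G B (char_Infl B U T (fT t)) x) =
      char_Ind G B (char_Infl B U T (map_ffun iota (fT t))) x.
    by rewrite -char_Infl_map -char_Ind_map [RHS]ffunE.
  rewrite fE def_i [RHS]ffunE; case: ifPn => [Gx | G'x]; last exact: cfun0.
  rewrite cfIndE //; congr (_ * _); apply: eq_bigr => y _; rewrite ffunE.
  case: ifPn => [Bxy | B'xy]; last exact: cfun0.
  have UTxy : (x ^ y)%g \in (U * T)%g by rewrite (sdprodW D).
  rewrite ffunE fTE {1}(divgr_eq U T (x ^ y)%g) cfSdprodE //.
    exact: mem_divgr.
  exact: mem_remgr.
have impP (chi : {ffun gT -> K}) :
    imprimitive G chi <-> is_irr_char G chi /\ chi 1%g = (q ^ 2 + 1)%N%:R.
  split=> [imp_chi | [irr_chi deg_chi]].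
    have [irr_chi _] := imp_chi; split=> //.
    have [H [n [ltHG Dn dvd_n]]] := imprimitive_index charK imp_chi.
    have [i def_chi] := (f_irr chi).1 irr_chi.
    have [n' Dn'] : exists n', 'chi[G]_i 1%g = n'%:R.
      by exists (Num.truncn ('chi_i 1%g)); rewrite truncnK ?Cnat_irr1.
    have def_n : n = n'.
      by apply/eqP; rewrite -natK -Dn def_chi (degE _ _ Dn').
    by rewrite Dn def_n (suzuki_imprimitive suzG ltHG Dn') // -def_n.
  split=> //; have [lam [_ linB ->]] := HC_P chi irr_chi deg_chi.
  exists B, (char_Infl B U T lam); split=> //; last by case: linB => rB ->; exists 1%N, rB.
  by apply/properP; split=> //; exists w; [exact: rk1_mem (suz_rk1 suzG) | exact: notin_w (suz_rk1 suzG)].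
split=> //.
  exists [seq map_ffun kappa (f i) | i : Iirr G]; split.
  - by rewrite map_inj_uniq // enum_uniq.
  - move=> chi; split=> [/mapP[i _ ->] | /f_irr[i ->]]; first by apply/f_irr; exists i.
    exact: map_f (mem_enum _ _).
  - by rewrite size_map -cardE.
exists [seq map_ffun kappa (f i) | i in XS]; split.
- by rewrite map_inj_uniq // enum_uniq.
- move=> chi; split=> [/mapP[i] | /impP[/f_irr[i ->] /degP XSi]].
    rewrite mem_enum => /XS_P[/degE Di _] ->; apply/impP; split=> //.
    by apply/f_irr; exists i.
  by apply: map_f; rewrite mem_enum.
- by rewrite size_map -cardE.
Qed.

End Transfer.

Theorem proposition10p2
  (K : closedFieldType) (charK : [pchar K] =i pred0)
  (m : nat) (m_ge1 : (1 <= m)%N)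
  (F : finFieldType) (cardF : #|F| = (2 ^ (2 * m).+1)%N) :
  let q := (2 ^ (2 * m).+1)%N in
  let G := suzuki cardF in
  let B := suzuki_borel cardF in
  let U := suzuki_unip cardF in
  let T := suzuki_torus cardF in
  [/\ forall chi : {ffun {'GL_4[F]} -> K},
        imprimitive G chi <->
        is_irr_char G chi /\ chi 1%g = (q ^ 2 + 1)%N%:R,
      forall chi : {ffun {'GL_4[F]} -> K},
        is_irr_char G chi -> chi 1%g = (q ^ 2 + 1)%N%:R ->
        exists lam : {ffun {'GL_4[F]} -> K},
          [/\ is_linear_char T lam,
              is_linear_char B (char_Infl B U T lam)
            & chi = HC_Ind G B U T lam],
      has_exactly
        (fun chi : {ffun {'GL_4[F]} -> K} => is_irr_char G chi) (q + 3)%N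
    & has_exactly
        (fun chi : {ffun {'GL_4[F]} -> K} => imprimitive G chi)
        (q %/ 2 - 1)%N].
Proof.
move=> q G B U T; have [w suzG] := suzuki_is_suzuki_like m_ge1 cardF.
exact: (suzuki_like_characters charK suzG).
Qed.
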